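(* Let $\{t_\theta,\theta\in\Theta'\}$ be a parametric set of densities on a measured space $(\mathcal X,\mathcal A,\mu)$, indexed by an open subset $\Theta'$ of $\mathbb R^d$, such that $\theta\mapsto t_\theta\cdot\mu$ is one-to-one. Let $\overline S=\{t_\theta,\theta\in\Theta\}$ with $\Theta\subset\Theta'$, let $X_1,\dots,X_n$ be i.i.d. with density $s$ with respect to $\mu$, and assume: (i) $\Theta$ is a compact and convex subset of $\Theta'$ and the true density $s$ is an element $t_\vartheta\in\overline S$ such that $\vartheta$ is an interior point of $\Theta$; (ii) the parametric family $\{t_\theta,\theta\in\Theta'\}$ is regular and the Fisher Information matrix is invertible on $\Theta$; (iii) there exists a constant $A_1$ such that $\left\|\sqrt{t_\theta/t_{\theta'}}-\sqrt{t_{\overline\theta}/t_{\theta'}}\right\|_\infty\le A_1|\overline\theta-\theta|$ for all $\theta,\overline\theta,\theta'\in\Theta$; (iv) with probability tending to one when $n$ goes to infinity, there exists a maximum likelihood estimator $\widetilde\theta_n$ (over $\Theta$) which is consistent. Let $S$ be an arbitrary countable and dense subset of $\overline S$. Then, with probability tending to $1$ as $n$ tends to infinity, $t_{\widetilde\theta_n}$ belongs to $\mathrm{Cl}(\mathcal E(\boldsymbol X,S))$ and is therefore a $\rho$-estimator.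
   Context: $\|t\|_\infty=\sup_{x\in\mathcal X}|t(x)|$ and $|\cdot|$ is the Euclidean norm on $\mathbb R^d$. ''Regular'' may be taken in the sense of Ibragimov and Has'minskii: $\theta\mapsto t_\theta(x)$ is continuous on $\Theta'$ for $\mu$-almost all $x$; $\theta\mapsto\sqrt{t_\theta}$ is differentiable in $L_2(\mu)$ at every $\theta\in\Theta'$; and its $L_2(\mu)$-derivative is a continuous function of $\theta$ in $L_2(\mu)$. The Fisher Information matrix is $4\int \dot g_\theta\dot g_\theta^{\top}d\mu$ with $\dot g_\theta$ the $L_2(\mu)$-derivative of $\sqrt{t_\theta}$. Hellinger distance and affinity: $h^2(t,t')=\frac12\int(\sqrt t-\sqrt{t'})^2d\mu$, $\rho(t,t')=\int\sqrt{tt'}\,d\mu$. Density of $S$ in $\overline S$ and closures are with respect to $h$. A density $t$ is identified with $\mathbf t=(t,\dots,t)$ ($n$ copies). Conventions: $0/0=1$, $x/0=+\infty$ for $x>0$. $\rho$-estimators. Let $\boldsymbol X=(X_1,\dots,X_n)$ with $n\ge3$, $\psi(u)=\frac{u-1}{\sqrt{1+u^2}}$ for $u\in[0,+\infty)$, $\psi(+\infty)=1$ and $\kappa=357$. For densities $t,t'$ and $r=(t+t')/2$, $\mathbf T(\boldsymbol X,\mathbf t,\mathbf t')=\frac n2[\rho(t',r)-\rho(t,r)]+\frac1{\sqrt2}\sum_{i=1}^n\psi\big(\sqrt{t'/t}(X_i)\big)$. For a countable set $S$ of densities, $\boldsymbol\Upsilon(S,\mathbf t)=\sup_{t'\in S}\mathbf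 T(\boldsymbol X,\mathbf t,\mathbf t')$, $\mathcal E(\boldsymbol X,S)=\{t\in S:\boldsymbol\Upsilon(S,\mathbf t)\le\inf_{u\in S}\boldsymbol\Upsilon(S,\mathbf u)+\kappa/10\}$ and $\mathrm{Cl}(\mathcal E(\boldsymbol X,S))$ is the set of densities at Hellinger distance $0$ from $\mathcal E(\boldsymbol X,S)$. A $\rho$-estimator based on $S$ is any (measurably chosen) element of $\mathrm{Cl}(\mathcal E(\boldsymbol X,S))$. *)

(* Defs.v *)
From HB Require Import structures.
From mathcomp Require Import all_boot all_order all_algebra.
From mathcomp Require Import all_classical all_reals all_analysis.

Set Implicit Arguments.
Unset Strict Implicit.
Unset Printing Implicit Defensive.

Import Order.TTheory GRing.Theory Num.Theory.
Import numFieldNormedType.Exports.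

Local Open Scope classical_set_scope.
Local Open Scope ring_scope.

Section Euclidean.
Context {R : realType} {d : nat}.

Definition dotv (u v : 'rV[R]_d) : R := \sum_(i < d) u 0 i * v 0 i.

(* The library norm on ['rV[R]_d] is the sup norm (with the same topology). *)
Definition enorm (v : 'rV[R]_d) : R := Num.sqrt (dotv v v).

End Euclidean.

Section Densities.
Context {dT : measure_display} {T : measurableType dT} {R : realType}.
Variable mu : {measure set T -> \bar R}.
Implicit Types (t u r : T -> R) (S E : set (T -> R)).

Definition is_density t : Prop :=
  [/\ measurable_fun setT t, forall x, 0 <= t x
    & (\int[mu]_x (t x)%:E = 1)%E].

Definition affinity t u : R := \int[mu]_x Num.sqrt (t x * u x).

Definition hellinger t u : R :=
  Num.sqrt (2^-1 * \int[mu]_x (Num.sqrt (t x) - Num.sqrt (u x)) ^+ 2).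

(* The densities at Hellinger distance [0] from [E]; the infimum over the
   empty set is [+oo], so [hclosure set0 = set0]. *)
Definition hclosure E : set (T -> R) :=
  [set t | is_density t /\
           ereal_inf [set (hellinger t u)%:E | u in E] = 0%E].

Definition countable_dense_subset S E : Prop :=
  [/\ countable S, S `<=` E & E `<=` hclosure S].

End Densities.

Section RhoEstimation.
Context {dT : measure_display} {T : measurableType dT} {R : realType}.
Variable mu : {measure set T -> \bar R}.
Implicit Types (t u : T -> R) (S : set (T -> R)).

(* Quotient of nonnegative reals with [0 / 0 = 1] and [a / 0 = +oo], [a > 0]. *)
Definition ratioe (a b : R) : \bar R :=
  if b == 0 then (if a == 0 then 1%E else +oo%E) else (a / b)%:E.

Definition sqrt_ratio t u (x : T) : \bar R := sqrte (ratioe (t x) (u x)).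

(* Only values on [[0, +oo]] are meaningful; [-oo] is never reached. *)
Definition psi (v : \bar R) : R :=
  match v with
  | r%:E => (r - 1) / Num.sqrt (1 + r ^+ 2)
  | +oo%E => 1
  | -oo%E => 0
  end.

Definition kappa : R := 357%:R.

Section Sample.
Context {n : nat}.
Variable X : 'I_n -> T.

Definition rho_T t u : R :=
  let r := fun x => (t x + u x) / 2 in
  n%:R / 2 * (affinity mu u r - affinity mu t r)
  + (Num.sqrt 2)^-1 * \sum_(i < n) psi (sqrt_ratio u t (X i)).

Definition Upsilon S t : \bar R := ereal_sup [set (rho_T t u)%:E | u in S].

Definition rho_E S : set (T -> R) :=
  [set t | S t /\ (Upsilon S t <=
     ereal_inf [set Upsilon S u | u in S] + (kappa / 10)%:E)%E].

End Sample.
End RhoEstimation.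

Section ParametricModel.
Context {dT : measure_display} {T : measurableType dT} {R : realType}.
Context {d : nat}.
Variable mu : {measure set T -> \bar R}.
Implicit Types (f t : 'rV[R]_d -> T -> R) (g : T -> 'rV[R]_d).

Definition is_L2_derivative f (theta : 'rV[R]_d) g : Prop :=
  (forall i : 'I_d, (fun x => g x 0 i) \in Lfun mu 2%:E) /\
  ('N[mu]_2%:E[(fun x => (f (theta + h) x - f theta x - dotv h (g x))%:E)]
     * (enorm h)^-1%:E)%E @[h --> (0 : 'rV[R]_d)^'] --> 0%E.

(* Regularity in the sense of Ibragimov and Has'minskii; [gdot theta] is the
   [L2 mu]-derivative of [sqrt (t theta)]. *)
Definition regular (Theta' : set 'rV[R]_d) t
    (gdot : 'rV[R]_d -> T -> 'rV[R]_d) : Prop :=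
  [/\ {ae mu, forall x, {within Theta', continuous (fun theta => t theta x)}},
      forall theta, Theta' theta ->
        is_L2_derivative (fun eta x => Num.sqrt (t eta x)) theta (gdot theta)
    & forall theta, Theta' theta ->
        'N[mu]_2%:E[(fun x => (enorm (gdot eta x - gdot theta x))%:E)]%E
          @[eta --> theta] --> 0%E].

Definition fisher_information g : 'M[R]_d :=
  \matrix_(i, j) (4 * \int[mu]_x (g x 0 i * g x 0 j)).

Definition is_MLE (Theta : set 'rV[R]_d) t (n : nat) (X : 'I_n -> T)
    (theta : 'rV[R]_d) : Prop :=
  Theta theta /\
  forall eta, Theta eta ->
    \prod_(i < n) t eta (X i) <= \prod_(i < n) t theta (X i).

End ParametricModel.

Section Sampling.
Context {dO : measure_display} {Omega : measurableType dO} {R : realType}.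
Variable P : probability Omega R.

(* The events [A n] are not required to be measurable: the inner
   probability of [A n] tends to [1]. *)
Definition with_probability_tending_to_1 (A : nat -> set Omega) : Prop :=
  exists2 E : nat -> set Omega,
    forall n, measurable (E n) /\ E n `<=` A n
  & P (E n) @[n --> \oo] --> 1%E.

Definition mutually_independent {dT : measure_display}
    {T : measurableType dT} (X : nat -> {RV P >-> T}) : Prop :=
  forall (J : seq nat) (B : nat -> set T),
    uniq J -> (forall j, measurable (B j)) ->
    P (\bigcap_(j in [set` J]) (X j @^-1` B j)) =
    (\prod_(j <- J) P (X j @^-1` B j))%E.

Definition iid_with_density {dT : measure_display} {T : measurableType dT}
    (mu : {measure set T -> \bar R}) (s : T -> R)
    (X : nat -> {RV P >-> T}) : Prop :=
  mutually_independent X /\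
  forall i (A : set T), measurable A ->
    distribution P (X i) A = (\int[mu]_(x in A) (s x)%:E)%E.

Definition sample {dT : measure_display} {T : measurableType dT}
    (X : nat -> {RV P >-> T}) (n : nat) (w : Omega) : 'I_n -> T :=
  fun i => X i w.

End Sampling.
Arguments sample {dO Omega R P dT T} X n w.

(* Main.v *)
(* Under (iii) all densities t_theta vanish at the same points, and the ratios
   W_theta = sqrt(t_theta / s) are bounded, bounded away from 0, and Lipschitz in theta
   for the sup norm. Since T(X, t, t) = 0, one has Upsilon >= 0 on S, so that t belongs to
   E(X, S) as soon as T(X, t, t') <= kappa / 10 for all t' in S; by continuity it is enough
   to prove T(X, t_mle, t_theta) <= 8 for all theta.

   Up to an error C n |theta - mle|^3, T(X, t_mle, t_theta) is half the sum of
   ln (W_theta / W_mle) (X_i), which is nonpositive by definition of the MLE. This settles the case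
   |theta - mle| <= K n^(-1/3). Moreover h^2(s, t_theta) >= c |theta - vartheta|^2, by the
   invertibility of the Fisher information near vartheta and by compactness elsewhere;
   with Chernoff bounds on a fine grid, the log-likelihood ratio
   sum_i ln W_theta (X_i) is at most - a n |theta - vartheta|^2 for all theta at distance at
   least K' n^(-1/3) from vartheta, with probability tending to 1. Hence the MLE is within
   K' n^(-1/3) of vartheta, and the quadratic term dominates the cubic one for
   |theta - mle| < delta0. For |theta - mle| >= delta0, the same grid argument applied to the
   rho-test of s against t_theta shows that it is at most - a' n. *)
Require Import Defs.
From HB Require Import structures.
From mathcomp Require Import all_boot all_order all_algebra.
From mathcomp Require Import all_classical all_reals all_analysis.
From mathcomp Require Import measurable_realfun ring lra.

Set Implicit Arguments.
Unset Strict Implicit.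
Unset Printing Implicit Defensive.

Import Order.TTheory GRing.Theory Num.Theory.
Import numFieldNormedType.Exports.

Local Open Scope classical_set_scope.
Local Open Scope ring_scope.

(** * Real inequalities *)

(** The scale n^(-1/3) is where two requirements meet. The cubic error n |theta - mle|^3 is bounded
    up to that radius; and there the Chernoff exponent n |theta - vartheta|^2 is already of order
    n^(1/3), which beats the polynomial cardinality of a grid of mesh 1/n. A plain union bound
    therefore suffices. The bounds have to be uniform in theta because the MLE is random.

    The integrals against mu become expectations of bounded functions of W under the law [Q] of one
    observation, so that integrability comes for free.

    The threshold leaves room: kappa / 10 = 35.7, whereas 8 comes from stopping the cubic regime at
    radius 2 eta0 n^(-1/3), with eta0 such that C eta0^3 <= 1. Since t_mle need not lie in S, it is
    approached by elements of S in Hellinger distance; compactness and identifiability turn this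
    into proximity of the parameters, and for fixed n the test is Lipschitz in the parameter, which
    costs at most 1 more. *)

Section RealInequalities.
Context {R : realType}.
Implicit Types a b u v w x y : R.

Lemma ge0_derive_homo (f df : R -> R) a b :
  (forall x, 0 < x -> is_derive x 1 f (df x)) -> (forall x, 0 < x -> 0 <= df x) ->
  0 < a -> a <= b -> f a <= f b.
Proof.
move=> fdf df0 a0 ab.
have fdf' x : x \in `]a, b[%R -> is_derive x 1 f (df x).
  by rewrite in_itv/= => /andP[ax _]; exact/fdf/(lt_trans a0).
have [|c] := MVT_segment ab fdf'.
  apply: derivable_within_continuous => x; rewrite in_itv/= => /andP[ax _].
  by have /fdf [] : 0 < x by exact: lt_le_trans ax.
rewrite in_itv/= => /andP[ac _] fba.
by rewrite -subr_ge0 fba mulr_ge0 ?subr_ge0// df0// (lt_le_trans a0).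
Qed.

(** The bound is [2 - 4 / (u + 1)], a Padé approximant of [ln] at 1, and [ln x + 4 / (x + 1)] has
    derivative [(x - 1)^2 / (x (x + 1)^2)]. *)
Lemma ln_ge_pade u : 1 <= u -> 2 * (u - 1) / (u + 1) <= ln u.
Proof.
move=> u1.
pose f x := ln x + 4 * (x + 1)^-1.
have : f 1 <= f u.
  apply: (@ge0_derive_homo _ (fun x => x^-1 - 4 * (x + 1) ^- 2)) => // x x0.
    have x1 : x + 1 != 0 by rewrite gt_eqF// addr_gt0.
    have x1' := is_derive1_ln x0.
    have x1'' : is_derive x 1 (fun y : R => (y + 1)^-1) (- (x + 1) ^- 2).
      have : is_derive x 1 (fun y : R => y + 1) 1.
        by rewrite -[X in is_derive _ _ _ X]addr0; exact: is_deriveD.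
      move=> h; rewrite -[X in is_derive _ _ _ X]mulr1.
      exact: is_deriveV.
    rewrite /f -mulrN.
    apply: is_deriveD.
  have -> : x^-1 - 4 * (x + 1) ^- 2 = (x - 1) ^+ 2 / (x * (x + 1) ^+ 2).
    by field; rewrite !gt_eqF// ?addr_gt0.
  by rewrite divr_ge0 ?sqr_ge0// mulr_ge0 ?sqr_ge0// ltW.
rewrite /f ln1 add0r (_ : 4 * (1 + 1)^-1 = 2); last by field.
move=> h.
have -> : 2 * (u - 1) / (u + 1) = 2 - 4 * (u + 1)^-1 by field; lra.
by rewrite lerBlDr.
Qed.

(** [x - 1 / x - 2 ln x] has derivative [(1 - 1 / x)^2] and vanishes at 1. *)
Lemma ln_ge_sub_inv v : 0 < v -> v <= 1 -> v - v^-1 <= 2 * ln v.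
Proof.
move=> v0 v1.
pose f x := x + (- x^-1 + - (2 * ln x)).
have : f v <= f 1.
  apply: (@ge0_derive_homo _ (fun x => 1 + (- - x ^- 2 + - (2 * x^-1)))) => // x x0.
    have x1' := is_derive1_ln x0.
    have x1'' : is_derive x 1 (fun y : R => y^-1) (- x ^- 2).
      have h := is_derive_id x (1 : R).
      rewrite -[X in is_derive _ _ _ X]mulr1.
      by apply: is_deriveV; rewrite gt_eqF.
    rewrite /f.
    apply: is_deriveD; apply: is_deriveD; apply: is_deriveN.
  have -> : 1 + (- - x ^- 2 + - (2 * x^-1)) = (1 - x^-1) ^+ 2.
    by field; rewrite gt_eqF.
  exact: sqr_ge0.
by rewrite /f ln1 invr1; lra.
Qed.


(** For [t = a^2 s] and [t' = b^2 s], this is [sqrt (r / s)] with [r] the mixture [(t + t') / 2] of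
    the rho-test. *)
Definition qmean a b : R := Num.sqrt ((a ^+ 2 + b ^+ 2) / 2).

Lemma qmeanC a b : qmean a b = qmean b a.
Proof. by rewrite /qmean addrC. Qed.

Lemma qmean_ge0 a b : 0 <= qmean a b. Proof. exact: sqrtr_ge0. Qed.

Lemma sqr_qmean a b : qmean a b ^+ 2 = (a ^+ 2 + b ^+ 2) / 2.
Proof. by rewrite sqr_sqrtr// divr_ge0// addr_ge0// sqr_ge0. Qed.

Lemma qmean_ge_mean a b : (a + b) / 2 <= qmean a b.
Proof.
rewrite real_leNgt ?num_real//; apply/negP => h.
have q0 := qmean_ge0 a b; have q2 := sqr_qmean a b.
have := sqr_ge0 (a - b); nra.
Qed.

(** 3/4 is a rational majorant of [1 / sqrt 2]. *)
Lemma qmean_le_add a b : 0 <= a -> 0 <= b -> qmean a b <= 3 / 4 * (a + b).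
Proof.
move=> a0 b0; rewrite real_leNgt ?num_real//; apply/negP => h.
have q2 := sqr_qmean a b; nra.
Qed.

Lemma qmean_le_max a b c : 0 <= a <= c -> 0 <= b <= c -> qmean a b <= c.
Proof.
move=> /andP[a0 ac] /andP[b0 bc]; rewrite real_leNgt ?num_real//; apply/negP => h.
have q2 := sqr_qmean a b; nra.
Qed.

Lemma qmean_lipschitz a a' b : `|qmean a b - qmean a' b| <= `|a - a'|.
Proof.
wlog aa : a a' / qmean a' b <= qmean a b.
  move=> H; have [|/ltW] := leP (qmean a' b) (qmean a b); first exact: H.
  by rewrite distrC (distrC a); exact: H.
rewrite ger0_norm ?subr_ge0// real_leNgt ?num_real//; apply/negP => h.
have q2 := sqr_qmean a b; have q2' := sqr_qmean a' b.
have q0 := qmean_ge0 a b; have q0' := qmean_ge0 a' b.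
have d0 : 0 <= `|a - a'| by [].
have d2 : `|a - a'| ^+ 2 = (a - a') ^+ 2 by rewrite real_normK ?num_real.
have qb : `|a'| <= 2 * qmean a' b.
  rewrite real_leNgt ?num_real//; apply/negP => h'.
  have : `|a'| ^+ 2 = a' ^+ 2 by rewrite real_normK ?num_real.
  have := sqr_ge0 b; nra.
have q2a : a' * (a - a') <= 2 * qmean a' b * `|a - a'|.
  apply: le_trans (ler_norm _) _; rewrite normrM.
  exact: ler_wpM2r.
nra.
Qed.

(* If [t = a ^ 2 s], [t' = b ^ 2 s] and [r = (t + t') / 2], then [score a b] is
   [psi (sqrt (t' / t)) / sqrt 2] and [s * drift a b] is the integrand of
   [rho(t', r) - rho(t, r)]. *)
Definition score a b : R := (b - a) / (2 * qmean a b).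

Definition drift a b : R := (b - a) * qmean a b.

Lemma score_opp a b : score a b = - score b a.
Proof. by rewrite /score qmeanC -mulNr opprB. Qed.

Lemma drift_opp a b : drift a b = - drift b a.
Proof. by rewrite /drift qmeanC -mulNr opprB. Qed.

Lemma qmean_gt0 a b : 0 < a -> 0 < b -> 0 < qmean a b.
Proof. by move=> a0 b0; apply: lt_le_trans (qmean_ge_mean a b); lra. Qed.

(* [score 1 u] and [ln u / 2] are both odd functions of [ln u] with the same
   derivative at [0], so that the error is of third order. *)
Lemma score1_le_ln u K : 0 < u -> 1 <= K -> K^-1 <= u ->
  score 1 u <= 2^-1 * ln u + K * `|u - 1| ^+ 3.
Proof.
move=> u0 K1 Ku; have K0 : 0 < K by lra.
have [u1|u1] := leP 1 u.
  have h := ln_ge_pade u1.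
  have : 0 <= K * `|u - 1| ^+ 3 by rewrite mulr_ge0 ?exprn_ge0//; lra.
  have : score 1 u <= (u - 1) / (u + 1).
    rewrite /score ler_pdivrMr ?mulr_gt0 ?qmean_gt0// mulrAC ler_pdivlMr; last lra.
    by apply: ler_wpM2l; [lra|have := qmean_ge_mean 1 u; lra].
  by move: h; rewrite -mulrA; lra.
pose v := Num.sqrt u.
have v0 : 0 < v by rewrite sqrtr_gt0.
have uv : u = v ^+ 2 by rewrite sqr_sqrtr// ltW.
have v1 : v < 1 by move: u1; rewrite uv; nra.
have hln : v - v^-1 <= ln u.
  by apply: le_trans (ln_ge_sub_inv v0 (ltW v1)) _; rewrite uv lnXn// mulr2n mulrDl !mul1r.
have -> : `|u - 1| = 1 - u by rewrite distrC ger0_norm//; lra.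
pose q := qmean 1 u.
have q0 : 0 < q by exact: qmean_gt0.
have q2 : q ^+ 2 = (1 + u ^+ 2) / 2 by rewrite sqr_qmean expr1n.
have qhalf : 1 / 2 <= q by have := qmean_ge_mean 1 u; rewrite -/q; lra.
suff : score 1 u <= 2^-1 * (v - v^-1) + K * (1 - u) ^+ 3.
  by move=> h; apply: le_trans h _; rewrite lerD2r ler_pM2l// invr_gt0.
(* An exact identity, by [q^2 - v^2 = (1 - u)^2 / 2]. Its denominator is at least [v], because
   [q >= 1 / 2], and [v >= u >= 1 / K]. *)
have -> : score 1 u = 2^-1 * (v - v^-1) +
    (1 - u) ^+ 3 / (4 * v * q * (q + v)).
  rewrite /score -/q [RHS](_ : _ = (2 * (v ^+2 - 1) * q * (q + v) + (1 - u) ^+ 3)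
    / (4 * v * q * (q + v))); last first.
    by field; rewrite !gt_eqF// addr_gt0.
  have -> : (1 - u) ^+ 3 = (1 - u) * (2 * (q ^+ 2 - v ^+ 2)).
    by rewrite q2 -uv; field.
  by rewrite uv; field; rewrite !gt_eqF// addr_gt0.
rewrite lerD2l mulrC ler_wpM2r ?exprn_ge0//; first lra.
have uv' : u <= v by rewrite uv; nra.
have vK : K^-1 <= v by lra.
rewrite invf_ple ?posrE ?mulr_gt0 ?addr_gt0//.
by apply: le_trans vK _; nra.
Qed.

(** [score] is homogeneous of degree 0, which reduces the bound to [a = 1]. *)
Lemma score_le_ln a b K : 0 < a -> 0 < b -> 1 <= K -> K^-1 <= b / a ->
  score a b <= 2^-1 * (ln b - ln a) + K * `|b / a - 1| ^+ 3.
Proof.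
move=> a0 b0 K1 Kab.
rewrite -ln_div ?posrE//; apply: le_trans (score1_le_ln _ K1 Kab); last exact: divr_gt0.
rewrite /score.
have -> : qmean a b = a * qmean 1 (b / a).
  rewrite /qmean; rewrite -[X in X * Num.sqrt _](@ger0_norm _ a) ?(ltW a0)//.
  rewrite -sqrtr_sqr -sqrtrM ?sqr_ge0//; congr Num.sqrt.
  by field; rewrite gt_eqF.
have q0 : qmean 1 (b / a) != 0 by rewrite gt_eqF// qmean_gt0// divr_gt0.
by rewrite le_eqVlt; apply/orP; left; apply/eqP; field; rewrite q0 gt_eqF.
Qed.

(** The left-hand side, at [w = W theta], integrates to the mean per observation of the test of the
    true density against [t theta]. As [w^2 - 1] integrates to 0, this mean is negative, of the
    order of the squared Hellinger distance. *)
Lemma score_drift_le w : 0 < w ->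
  score 1 w + drift 1 w / 2 <= (w ^+ 2 - 1) / 2 - (w - 1) ^+ 2 / 30.
Proof.
move=> w0; rewrite /score /drift; set p := qmean 1 w.
have p0 : 0 < p by exact: qmean_gt0.
have p2 : p ^+ 2 = (1 + w ^+ 2) / 2 by rewrite sqr_qmean expr1n.
have pm : (1 + w) / 2 <= p by exact: qmean_ge_mean.
have pM : p <= 3 / 4 * (1 + w) by apply: qmean_le_add => //; exact: ltW.
rewrite -subr_ge0.
have -> : (w ^+ 2 - 1) / 2 - (w - 1) ^+ 2 / 30 - ((w - 1) / (2 * p) + (w - 1) * p / 2) =
  ((w ^+ 2 - 1) * p - (w - 1) ^+ 2 * p / 15 - (w - 1) * (1 + p ^+ 2)) / (2 * p).
  by field; rewrite gt_eqF.
rewrite divr_ge0//; last by rewrite mulr_ge0// ltW.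
(* Multiplying by this conjugate brings out the factor [(w - 1)^2]. With [m = (1 + w) / 2], the
   other factor is [p + m^2 - p (p + m) / 15], which is nonnegative since [p <= 3 m / 2]. *)
have pm0 : 0 < p + (1 + w) / 2 by lra.
rewrite -(pmulr_lge0 _ pm0).
have -> : 1 + p ^+ 2 = 2 * p ^+ 2 - (w ^+ 2 - 1) / 2 by rewrite p2; field.
have pp : (p - (1 + w) / 2) * (p + (1 + w) / 2) = (w - 1) ^+ 2 / 4.
  by rewrite -subr_sqr p2; field.
have -> : ((w ^+ 2 - 1) * p - (w - 1) ^+ 2 * p / 15
    - (w - 1) * (2 * p ^+ 2 - (w ^+ 2 - 1) / 2)) * (p + (1 + w) / 2) =
  (w - 1) ^+ 2 * ((1 + w) / 2 * (p + (1 + w) / 2) - (w - 1) / 2 * p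
    - p * (p + (1 + w) / 2) / 15)
  + 2 * p * (w - 1) * ((w - 1) ^+ 2 / 4 - (p - (1 + w) / 2) * (p + (1 + w) / 2)).
  by field.
rewrite pp subrr mulr0 addr0 mulr_ge0 ?sqr_ge0//; nra.
Qed.

(* [b ^ 2 - a ^ 2] integrates to [0] against the true density. *)
Lemma drift_cubic a b B : 0 < B -> B^-1 <= a -> B^-1 <= b ->
  `|drift a b - (b ^+ 2 - a ^+ 2) / 2| <= B * `|b - a| ^+ 3.
Proof.
move=> B0 Ba Bb; have Bi : 0 < B^-1 by rewrite invr_gt0.
rewrite /drift; set p := qmean a b.
have p2 : p ^+ 2 = (a ^+ 2 + b ^+ 2) / 2 by exact: sqr_qmean.
have pm : (a + b) / 2 <= p by exact: qmean_ge_mean.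
have -> : (b - a) * p - (b ^+ 2 - a ^+ 2) / 2 = (b - a) * (p - (a + b) / 2) by field.
rewrite normrM exprS mulrCA ler_wpM2l// ger0_norm; last lra.
rewrite real_normK ?num_real//.
have pp : (p - (a + b) / 2) * (p + (a + b) / 2) = (b - a) ^+ 2 / 4.
  by rewrite -subr_sqr p2; field.
have : B^-1 * (p - (a + b) / 2) <= (b - a) ^+ 2.
  apply: (@le_trans _ _ ((p - (a + b) / 2) * (p + (a + b) / 2))).
    rewrite mulrC; apply: ler_wpM2l; lra.
  rewrite pp; have := sqr_ge0 (b - a); lra.
by move=> h; rewrite -ler_pdivrMl.
Qed.

Lemma drift_lipschitz a a' b B : 0 <= a <= B -> 0 <= a' <= B -> 0 <= b <= B ->
  `|drift a b - drift a' b| <= 2 * B * `|a - a'|.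
Proof.
move=> aB a'B bB; rewrite /drift.
have -> : (b - a) * qmean a b - (b - a') * qmean a' b =
  (a' - a) * qmean a b + (b - a') * (qmean a b - qmean a' b) by ring.
rewrite -mulrA mulr_natl mulr2n; apply: le_trans (ler_normD _ _) _.
rewrite !normrM; apply: lerD.
  by rewrite distrC mulrC ler_wpM2r// ger0_norm ?qmean_ge0// qmean_le_max.
apply: ler_pM => //; last exact: qmean_lipschitz.
by rewrite ler_norml; lra.
Qed.

Lemma score_lipschitz a a' b B : 1 <= B -> B^-1 <= a <= B -> B^-1 <= a' <= B ->
  B^-1 <= b <= B -> `|score a b - score a' b| <= B ^+ 3 * `|a - a'|.
Proof.
move=> B1 /andP[aB1 aB2] /andP[a'B1 a'B2] /andP[bB1 bB2].
have B0 : 0 < B by lra.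
have Bi : 0 < B^-1 by rewrite invr_gt0.
have a0 : 0 < a by lra. have a'0 : 0 < a' by lra. have b0 : 0 < b by lra.
rewrite /score; set p := qmean a b; set p' := qmean a' b.
have pB : p <= B by apply: qmean_le_max; lra.
have p1 : B^-1 <= p by apply: le_trans (qmean_ge_mean a b); lra.
have p'1 : B^-1 <= p' by apply: le_trans (qmean_ge_mean a' b); lra.
have p0 : 0 < p by lra. have p'0 : 0 < p' by lra.
have -> : (b - a) / (2 * p) - (b - a') / (2 * p') =
  ((a' - a) * p + (b - a) * (p' - p)) / (2 * p * p').
  by field; rewrite !gt_eqF.
have num : `|(a' - a) * p + (b - a) * (p' - p)| <= 2 * B * `|a - a'|.
  rewrite -mulrA mulr_natl mulr2n; apply: le_trans (ler_normD _ _) _.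
  rewrite !normrM; apply: lerD.
    by rewrite distrC mulrC ler_wpM2r// ger0_norm// ltW.
  apply: ler_pM => //; last by rewrite distrC; exact: qmean_lipschitz.
  by rewrite ler_norml; lra.
have den : B^-1 ^+ 2 <= p * p' by rewrite expr2; apply: ler_pM; lra.
rewrite normrM normfV (@ger0_norm _ (2 * p * p')); last by rewrite !mulr_ge0// ltW.
rewrite ler_pdivrMr ?mulr_gt0//; apply: le_trans num _.
have -> : B ^+ 3 * `|a - a'| * (2 * p * p') = 2 * B * `|a - a'| * (B ^+ 2 * (p * p')) by ring.
apply: ler_peMr; first by rewrite !mulr_ge0// ltW.
by rewrite mulrC -ler_pdivrMr ?exprn_gt0// div1r -exprVn.
Qed.

Lemma ln_lipschitz a b B : 0 < B -> B^-1 <= a -> B^-1 <= b ->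
  `|ln a - ln b| <= B * `|a - b|.
Proof.
move=> B0 aB bB; have Bi : 0 < B^-1 by rewrite invr_gt0.
wlog ab : a b aB bB / a <= b.
  move=> H; have [|/ltW] := leP a b; first exact: H.
  by rewrite distrC (distrC a); exact: H.
have a0 : 0 < a by lra. have b0 : 0 < b by lra.
rewrite distrC (distrC a) !ger0_norm ?subr_ge0 ?ler_ln ?posrE//.
rewrite -ln_div ?posrE//.
have -> : b / a = 1 + (b - a) / a by field; rewrite gt_eqF.
apply: le_trans (le_ln1Dx _) _.
  by apply: lt_le_trans (_ : 0 <= _); [lra|rewrite divr_ge0 ?subr_ge0// ltW].
by rewrite mulrC; apply: ler_wpM2r; [lra|rewrite invf_ple ?posrE].
Qed.

(** [exp x <= 1 / (1 - x)], and [(1 + x + 2 x^2) (1 - x) = 1 + x^2 (1 - 2 x)]. *)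
Lemma expR_le_quad x : `|x| <= 2^-1 -> expR x <= 1 + x + 2 * x ^+ 2.
Proof.
rewrite ler_norml => /andP[x1 x2].
have h := expR_ge1Dx (- x); have e0 := expR_gt0 x.
have : expR x * (1 - x) <= 1.
  by rewrite -[leRHS](expRxMexpNx_1 x) ler_pM2l.
have : 1 <= (1 + x + 2 * x ^+ 2) * (1 - x) by have := sqr_ge0 x; nra.
nra.
Qed.

End RealInequalities.

(** * Independence and exponential inequalities *)

Section Transport.
Context {d1 d2 : measure_display} {U : measurableType d1} {T : measurableType d2}.
Context {R : realType}.
Variables (m : {measure set U -> \bar R}) (Q : {measure set T -> \bar R}).
Variables (Y : U -> R) (Z : U -> T) (c : R).
Hypotheses (mY : measurable_fun setT Y) (Y0 : forall w, 0 <= Y w).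
Hypotheses (mZ : measurable_fun setT Z) (c0 : 0 <= c).
Hypothesis YZQ : forall B, measurable B ->
  (\int[m]_w (Y w * \1_B (Z w))%:E = c%:E * Q B)%E.

Import HBNNSimple.

Let integral_transport_nnsfun (f : {nnsfun T >-> R}) :
  (\int[m]_w (Y w * f (Z w))%:E = c%:E * \int[Q]_x (f x)%:E)%E.
Proof.
have mYi y : measurable_fun setT (fun w => Y w * \1_(f @^-1` [set y]) (Z w)).
  apply: measurable_funM => //; apply: (measurableT_comp _ mZ) => //.
transitivity (\int[m]_w \sum_(y \in range f)
    (y%:E * (Y w * \1_(f @^-1` [set y]) (Z w))%:E))%E.
  apply: eq_integral => w _; rewrite fimfunE mulrC -[LHS]/((_ * _)%:E)%E mulrC.
  rewrite EFinM -fsumEFin// ge0_mule_fsumr//; last by move=> y; rewrite EFinM nnfun_muleindic_ge0.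
  by apply: eq_fsbigr => y _; rewrite -!EFinM mulrCA.
rewrite ge0_integral_fsum//; last 2 first.
- by move=> y; apply/measurable_EFinP; exact: measurable_funM.
- move=> y w _; rewrite -EFinM mulrCA lee_fin mulr_ge0//.
  exact: nnfun_muleindic_ge0.
rewrite integralT_nnsfun sintegralE ge0_mule_fsumr; last first.
  by move=> y; exact: nnsfun_mulemu_ge0.
apply: eq_fsbigr => y; rewrite inE => -[x _ <-].
rewrite ge0_integralZl//.
- by rewrite YZQ// muleCA.
- exact/measurable_EFinP.
- by move=> w _; rewrite lee_fin mulr_ge0.
- by rewrite lee_fin.
Qed.

(** The hypothesis says that the image under [Z] of the measure with density [Y] is [c Q]; simple
    functions and monotone convergence extend it from indicators to [g]. It serves twice: for
    independence, where [Y] is the product of the other factors and [Z] is one observation, and for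
    the passage from [mu] to [Q], where [Y] is the true density and [Z] the identity. *)
Lemma ge0_integral_transport (g : T -> R) : measurable_fun setT g -> (forall x, 0 <= g x) ->
  (\int[m]_w (Y w * g (Z w))%:E = c%:E * \int[Q]_x (g x)%:E)%E.
Proof.
move=> mg g0.
have mg' : measurable_fun setT (EFin \o g) by exact/measurable_EFinP.
have g0' x : setT x -> (0 <= (EFin \o g) x)%E by move=> _; rewrite lee_fin.
pose f_ := nnsfun_approx measurableT mg'.
have fcvg x : EFin \o f_ ^~ x @ \oo --> (g x)%:E by exact: (cvg_nnsfun_approx _ _ g0').
have fnd x : {homo (fun n => f_ n x) : a b / (a <= b)%N >-> a <= b}.
  by move=> a b ab; exact/lefP/nd_nnsfun_approx.
have intQ : (\int[Q]_x (f_ n x)%:E @[n --> \oo] --> \int[Q]_x (g x)%:E)%E.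
  have -> : (\int[Q]_x (g x)%:E = \int[Q]_x (limn (EFin \o f_ ^~ x)))%E.
    by apply: eq_integral => x _; apply/esym/cvg_lim.
  apply: cvg_monotone_convergence => //.
  - by move=> n; exact/measurable_EFinP.
  - by move=> n x _; rewrite lee_fin.
  - by move=> x _ a b ab; rewrite lee_fin; exact: fnd.
have intm : (\int[m]_w (Y w * f_ n (Z w))%:E @[n --> \oo] --> \int[m]_w (Y w * g (Z w))%:E)%E.
  have -> : (\int[m]_w (Y w * g (Z w))%:E = \int[m]_w (limn (fun n => (Y w * f_ n (Z w))%:E)))%E.
    apply: eq_integral => w _; apply/esym/cvg_lim => //.
    under eq_fun do rewrite EFinM.
    by rewrite EFinM; apply: cvgeZl => //; exact: fcvg.
  apply: cvg_monotone_convergence => //.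
  - move=> n; apply/measurable_EFinP/measurable_funM => //.
    exact: measurableT_comp.
  - by move=> n x _; rewrite lee_fin mulr_ge0.
  - by move=> x _ a b ab; rewrite lee_fin ler_wpM2l//; exact: fnd.
apply: (cvg_unique _ intm) => //.
rewrite [X in X @ _](_ : _ = fun n => c%:E * \int[Q]_x (f_ n x)%:E)%E; last first.
  by apply/funext => n; exact: integral_transport_nnsfun.
exact: cvgeZl.
Qed.

End Transport.

Lemma measurable_superlevel d (U : measurableType d) (R : realType) (f : U -> R) (b : R) :
  measurable_fun setT f -> measurable [set w | b <= f w].
Proof.
move=> mf; rewrite -[X in measurable X]setTI.
have H := @measurable_fun_ler _ _ _ setT (cst b) f.
by apply: (H _ _ measurableT [set true]) => //.
Qed.

Section Independence.
Context {dO dT : measure_display} {Omega : measurableType dO} {T : measurableType dT}.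
Context {R : realType}.
Variables (P : probability Omega R) (X : nat -> {RV P >-> T}).
Variable Q : {measure set T -> \bar R}.
Hypothesis X_indep : mutually_independent X.
Hypothesis X_law : forall i B, measurable B -> P (X i @^-1` B) = Q B.

Let measurable_bigprod (s : seq nat) (h : nat -> Omega -> R) :
  (forall i, measurable_fun setT (h i)) -> measurable_fun setT (fun w => \prod_(i <- s) h i w).
Proof.
move=> mh; elim: s => [|i s ih].
  by under eq_fun do rewrite big_nil; exact: measurable_cst.
by under eq_fun do rewrite big_cons; exact: measurable_funM.
Qed.

Let prob_prod (s : seq nat) (B : nat -> set T) : uniq s -> (forall i, measurable (B i)) ->
  (\int[P]_w (\prod_(i <- s) \1_(B i) (X i w) : R)%:E = \prod_(i <- s) Q (B i))%E.
Proof.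
move=> us mB.
transitivity (P (\bigcap_(j in [set` s]) (X j @^-1` B j))).
  rewrite -[\bigcap_(j in _) _]setIT -integral_indic//; last first.
    rewrite bigcap_seq; apply: bigsetI_measurable => i _.
    by rewrite -[_ @^-1` _]setTI; exact: measurable_funP.
  apply: eq_integral => w _; congr EFin; rewrite bigcap_seq.
  elim: s {us} => [|i s ih]; first by rewrite !big_nil indicT.
  by rewrite !big_cons indicI ih.
rewrite X_indep//; apply: eq_bigr => i _; exact: X_law.
Qed.

(* The indicators are replaced by [f] one coordinate at a time. *)
Let integral_prod_mixed (f : T -> R) (r s : seq nat) (B : nat -> set T) (e : R) :
  measurable_fun setT f -> (forall x, 0 <= f x) -> (\int[Q]_x (f x)%:E = e%:E)%E ->
  uniq (r ++ s) -> (forall i, measurable (B i)) ->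
  (\int[P]_w ((\prod_(i <- r) f (X i w)) * (\prod_(i <- s) \1_(B i) (X i w)))%:E =
   (e ^+ size r)%:E * \prod_(i <- s) Q (B i))%E.
Proof.
move=> mf f0 fe; elim: r s B => [|k r ih] s B urs mB.
  rewrite mul1e -prob_prod//; apply: eq_integral => w _.
  by rewrite big_nil mul1r.
have e0 : 0 <= e.
  by rewrite -lee_fin -fe; apply: integral_ge0 => x _; rewrite lee_fin.
have finQ A : measurable A -> (Q A \is a fin_num)%E.
  move=> mA; rewrite -(X_law 0)//; apply: fin_num_measure.
  by rewrite -[_ @^-1` _]setTI; exact: measurable_funP.
have pfin : (\prod_(i <- s) Q (B i) \is a fin_num)%E.
  by elim/big_ind: _ => // [a b|i _]; [exact: fin_numM|exact: finQ].
pose c := e ^+ size r * fine (\prod_(i <- s) Q (B i))%E.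
have c0 : 0 <= c.
  by rewrite mulr_ge0 ?exprn_ge0// fine_ge0//; apply: prode_ge0 => i _.
pose Y w := (\prod_(i <- r) f (X i w)) * (\prod_(i <- s) \1_(B i) (X i w) : R).
have mY : measurable_fun setT Y.
  apply: measurable_funM; apply: measurable_bigprod => i.
    exact: measurableT_comp.
  by apply: measurableT_comp => //; exact: measurable_indic.
have Y0 w : 0 <= Y w.
  by rewrite mulr_ge0//; by apply: prodr_ge0 => i _.
have YB A : measurable A -> (\int[P]_w (Y w * \1_A (X k w))%:E = c%:E * Q A)%E.
  move=> mA.
  have ks : k \notin s.
    by move: urs => /= /andP[+ _]; rewrite mem_cat negb_or => /andP[].
  (* The coordinate [k] joins the indicators with an arbitrary set [A]: this is the identity on
     indicators that the transport lemma requires. *)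
  have := ih (k :: s) (fun i => if i == k then A else B i).
  have -> : uniq (r ++ k :: s).
    by rewrite -cat1s uniq_catCA.
  move=> /(_ isT) h; rewrite /c EFinM fineK// -muleA (muleC (\prod_(_ <- _) _)%E).
  transitivity (\int[P]_w (\prod_(i <- r) f (X i w) *
    \prod_(i <- k :: s) \1_(if i == k then A else B i) (X i w))%:E)%E.
    apply: eq_integral => w _; rewrite big_cons eqxx /Y mulrAC -mulrA; congr (_ * (_ * _))%:E.
    apply: eq_big_seq => i si; rewrite ifN//; by apply: contraNneq ks => <-.
  rewrite h; last by move=> i; case: ifP.
  rewrite big_cons eqxx; congr (_ * (_ * _))%E.
  apply: eq_big_seq => i si; rewrite ifN//; by apply: contraNneq ks => <-.
transitivity (\int[P]_w (Y w * f (X k w))%:E)%E.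
  apply: eq_integral => w _; rewrite big_cons /Y; congr EFin.
  by rewrite [RHS]mulrC mulrA.
rewrite (@ge0_integral_transport _ _ _ _ _ P Q Y (X k) c)//.
by rewrite fe /c EFinM fineK// muleAC -EFinM exprSr.
Qed.

Lemma integral_prod_indep (f : T -> R) (s : seq nat) (e : R) : uniq s ->
  measurable_fun setT f -> (forall x, 0 <= f x) -> (\int[Q]_x (f x)%:E = e%:E)%E ->
  (\int[P]_w (\prod_(i <- s) f (X i w))%:E = (e ^+ size s)%:E)%E.
Proof.
move=> us mf f0 fe.
have := @integral_prod_mixed f s [::] (fun=> setT) e mf f0 fe.
rewrite cats0 big_nil mule1 => <- //.
by apply: eq_integral => w _; rewrite big_nil mulr1.
Qed.

(** Markov's inequality for the exponential of the sum; the free parameter of Chernoff's method is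
    absorbed in [g]. *)
Lemma chernoff (g : T -> R) (n : nat) (e b : R) : measurable_fun setT g ->
  (\int[Q]_x (expR (g x))%:E = e%:E)%E ->
  (P [set w | (b <= \sum_(i < n) g (X i w))%R] <= (expR (- b) * e ^+ n)%:E)%E.
Proof.
move=> mg ge.
have meg : measurable_fun setT (fun x => expR (g x)).
  by apply: measurableT_comp => //; exact: measurable_expR.
have := @integral_prod_indep (fun x => expR (g x)) (iota 0 n) e (iota_uniq 0 n) meg
  (fun x => expR_ge0 _) ge.
rewrite size_iota => h.
have mprod : measurable_fun setT (fun w => \prod_(i <- iota 0 n) expR (g (X i w))).
  by apply: measurable_bigprod => i; exact: (measurableT_comp meg).
have msum : measurable_fun setT (fun w => \sum_(i < n) g (X i w)).
  by apply: measurable_sum => i; exact: measurableT_comp.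
pose A := [set w | b <= \sum_(i < n) g (X i w)].
have mA : measurable A by exact: measurable_superlevel.
rewrite EFinM -h -ge0_integralZl//; last 2 first.
- exact/measurable_EFinP.
- by move=> w _; rewrite lee_fin; apply: prodr_ge0 => i _; exact: expR_ge0.
rewrite -/A -[in leLHS](setIT A) -integral_indic//; apply: ge0_le_integral => //.
- exact/measurable_EFinP/measurable_indic.
- by under eq_fun do rewrite -EFinM; exact/measurable_EFinP/measurable_funM.
move=> w _; rewrite -EFinM lee_fin indicE.
rewrite -expR_sum -[in X in \sum_(i <- X) _](subn0 n) -/(index_iota 0 n) big_mkord -expRD.
case: (boolP (w \in A)) => [|_]; last exact: expR_ge0.
by rewrite inE /A/= => bw; rewrite -expR0 ler_expR addrC subr_ge0.
Qed.

End Independence.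

(** * Events of probability tending to 1 *)

Section Asymptotics.
Context {dO : measure_display} {Omega : measurableType dO} {R : realType}.
Variable P : probability Omega R.

Lemma wpt1_of_bound (A E : nat -> set Omega) : (forall n, measurable (E n)) ->
  (forall e : R, 0 < e -> exists N, forall n, (N <= n)%N ->
     E n `<=` A n /\ (P (~` E n) <= e%:E)%E) ->
  with_probability_tending_to_1 P A.
Proof.
move=> mE EA.
(* The inclusion in [A n] is required for every [n] but known only for large ones; the empty set
   fills the gap. *)
pose F n := if pselect (E n `<=` A n) then E n else set0.
have mF n : measurable (F n).
  by rewrite /F; case: (pselect _) => ?; [exact: mE|exact: measurable0].
exists F; first by move=> n; split => //; rewrite /F; case: (pselect _) => // ?; exact: sub0set.
apply/fine_cvgP; split; first by apply: nearW => n; exact: fin_num_measure.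
apply/cvgrPdist_le => e e0.
have [N HN] := EA _ e0; exists N => // n /= /HN[EAn PE].
rewrite /F; case: (pselect _) => // ?.
have PEfin : P (E n) \is a fin_num by exact: fin_num_measure.
have P1 : fine (P (E n)) <= 1 by rewrite -lee_fin fineK// probability_le1.
rewrite ger0_norm ?subr_ge0//.
by rewrite -lee_fin EFinB fineK// -probability_setC.
Qed.

Lemma wpt1_bound (A : nat -> set Omega) : with_probability_tending_to_1 P A ->
  exists2 E : nat -> set Omega, (forall n, measurable (E n) /\ E n `<=` A n) &
  forall e : R, 0 < e -> exists N, forall n, (N <= n)%N -> (P (~` E n) <= e%:E)%E.
Proof.
move=> [E EA] /fine_cvgP[_ /cvgrPdist_le cE]; exists E => // e e0.
have [N _ HN] := cE _ e0; exists N => n /HN/= {}HN.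
have [mE _] := EA n.
have PEfin : P (E n) \is a fin_num by exact: fin_num_measure.
rewrite probability_setC// -[P (E n)]fineK// -EFinB lee_fin.
exact: le_trans (ler_norm _) HN.
Qed.

Lemma wpt1_impl2 (A B C : nat -> set Omega) (N : nat) :
  (forall n, (N <= n)%N -> A n `&` B n `<=` C n) ->
  with_probability_tending_to_1 P A -> with_probability_tending_to_1 P B ->
  with_probability_tending_to_1 P C.
Proof.
move=> ABC /wpt1_bound[E1 EA H1] /wpt1_bound[E2 EB H2].
have mE1 n : measurable (E1 n) by have [] := EA n.
have mE2 n : measurable (E2 n) by have [] := EB n.
apply: (@wpt1_of_bound _ (fun n => E1 n `&` E2 n)) => [n|e e0].
  exact: measurableI.
have e20 : 0 < e / 2 by rewrite divr_gt0.
have [N1 {}H1] := H1 _ e20; have [N2 {}H2] := H2 _ e20.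
exists (maxn N (maxn N1 N2)) => n; rewrite !geq_max => /and3P[Nn N1n N2n]; split.
  apply: subset_trans (ABC n Nn).
  by apply: setISS; [case: (EA n)|case: (EB n)].
rewrite setCI; apply: le_trans (measureU2 _ (measurableC (mE1 n)) (measurableC (mE2 n))) _.
by rewrite (splitr e) EFinD leeD// ?H1 ?H2.
Qed.

End Asymptotics.

(** * The scale n^(1/3) *)

Section CubeRoot.
Context {R : realType}.

Definition cbrt (n : nat) : R := n%:R `^ 3^-1.

Lemma cbrt_ge0 n : 0 <= cbrt n. Proof. exact: powR_ge0. Qed.

Lemma cbrt3 n : cbrt n ^+ 3 = n%:R.
Proof. by rewrite -powR_mulrn ?cbrt_ge0// /cbrt -powRrM mulVf// powRr1. Qed.

Lemma cbrt_ge a : exists N, forall n, (N <= n)%N -> a <= cbrt n.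
Proof.
exists (Num.bound (`|a| ^+ 3)) => n Nn; apply: le_trans (ler_norm a) _.
rewrite -(ler_pXn2r (isT : (0 < 3)%N)) ?nnegrE ?cbrt_ge0// cbrt3.
have := archi_boundP (exprn_ge0 3 (normr_ge0 a)) => /ltW h.
by apply: le_trans h _; rewrite ler_nat.
Qed.

Lemma poly_exp_decay (K0 d : nat) (a : R) : 0 < a -> forall e, 0 < e ->
  exists N, forall n, (N <= n)%N ->
  ((K0 * n).+1 ^ d)%:R * expR (- (a * cbrt n)) <= e.
Proof.
move=> a0 e e0.
(* [n^d] is [cbrt n] to the power [3 d]; the term of order [3 d + 1] of the exponential series gains
   one more power and leaves [C / cbrt n]. *)
pose N1 := (3 * d)%N.
pose C := (K0.+1 ^ d)%:R * (N1.+1)`!%:R / a ^+ N1.+1 : R.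
have C0 : 0 <= C by rewrite divr_ge0// exprn_ge0// ltW.
have [N HN] := cbrt_ge (Num.max 1 (C / e)).
exists N => n /HN; rewrite ge_max => /andP[x1 xC].
have x0 : 0 < cbrt n by lra.
have n1 : (1 <= n)%N by rewrite -(ltr0n R) -cbrt3 exprn_gt0.
have Kn : ((K0 * n).+1 ^ d)%:R <= (K0.+1 ^ d)%:R * cbrt n ^+ N1.
  rewrite /N1 exprM cbrt3 -natrX -natrM ler_nat -expnMn.
  have [->|d0] := posnP d; first by rewrite !expn0.
  rewrite leq_exp2r// mulSn; apply: leq_trans (_ : 1 + K0 * n <= _)%N => //.
  by rewrite leq_add2r.
apply: (@le_trans _ _ (C / cbrt n)); last first.
  by rewrite ler_pdivrMr// mulrC -ler_pdivrMr.
rewrite expRN.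
have ax : 0 < a * cbrt n by rewrite mulr_gt0.
have hexp : (a * cbrt n) ^+ N1.+1 / (N1.+1)`!%:R <= expR (a * cbrt n).
  by have := expR_ge1Dxn N1 (ltW ax); lra.
have f0 : 0 < (N1.+1)`!%:R :> R by rewrite ltr0n fact_gt0.
have h0 : 0 < (a * cbrt n) ^+ N1.+1 / (N1.+1)`!%:R by rewrite divr_gt0// exprn_gt0.
apply: (@le_trans _ _ ((K0.+1 ^ d)%:R * cbrt n ^+ N1 * ((a * cbrt n) ^+ N1.+1 / (N1.+1)`!%:R)^-1)).
  by apply: ler_pM => //; rewrite ?invr_ge0 ?expR_ge0// lef_pV2 ?posrE ?expR_gt0.
rewrite le_eqVlt; apply/orP; left; apply/eqP; rewrite /C exprMn (exprS (cbrt n)).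
by field; rewrite !gt_eqF// ?exprn_gt0//.
Qed.

End CubeRoot.

(** * Finite nets of the parameter set *)

Section Grid.
Context {R : realType} {d : nat}.
Local Notation V := 'rV[R]_d.

Lemma rV_norm_le (v : V) (e : R) : 0 <= e -> (forall i, `|v 0 i| <= e) -> `|v| <= e.
Proof.
move=> e0 ve; rewrite [`|v|]mx_normrE; elim/big_ind: _ => //.
  by move=> x y xe ye; rewrite ge_max xe.
by move=> [i j] _ /=; rewrite ord1.
Qed.

Lemma rV_coord_le_norm (v : V) i : `|v 0 i| <= `|v|.
Proof.
rewrite [leRHS]mx_normrE.
by rewrite (bigD1 (0, i))//= le_max lexx.
Qed.

(** The points of the net must lie in [Theta], where the hypotheses on the model hold: a cell is
    represented by one of its own parameters, and by [theta0] if it contains none. *)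
Lemma exists_grid (Theta : set V) (M : R) (theta0 : V) (k : nat) :
  0 < M -> (forall theta, Theta theta -> `|theta| <= M) -> Theta theta0 -> (0 < k)%N ->
  exists rep : {ffun 'I_d -> 'I_k.+1} -> V, (forall j, Theta (rep j)) /\
    forall theta, Theta theta -> exists j, `|theta - rep j| <= 2 * M / k%:R.
Proof.
move=> M0 TM T0 k0; have k0' : 0 < k%:R :> R by rewrite ltr0n.
pose y (theta : V) i : R := k%:R * (theta 0 i + M) / (2 * M).
have yP theta i : Theta theta -> 0 <= y theta i <= k%:R.
  move=> /TM h; have := le_trans (rV_coord_le_norm theta i) h.
  rewrite ler_norml => /andP[h1 h2]; rewrite /y divr_ge0 ?mulr_ge0//=; [|lra|lra].
  by rewrite ler_pdivrMr ?mulr_gt0// ler_pM2l//; lra.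
(* A coordinate equal to [M] has index [k], whence [k.+1] indices along each axis. *)
pose cell theta : {ffun 'I_d -> 'I_k.+1} := [ffun i => inord (Num.truncn (y theta i))].
pose rep j := xget theta0 [set theta | Theta theta /\ cell theta = j].
have repP theta : Theta theta -> Theta (rep (cell theta)) /\ cell (rep (cell theta)) = cell theta.
  by move=> Tt; apply: (@xgetPex _ theta0 [set eta | Theta eta /\ cell eta = cell theta]); exists theta.
exists rep; split.
  by move=> j; rewrite /rep; case: xgetP => [x _ []|].
move=> theta Tt; exists (cell theta); have [Tr cr] := repP _ Tt.
set eta := rep _ in Tr cr *.
apply: rV_norm_le => [|i]; first by rewrite divr_ge0// mulr_ge0// ltW.
have /andP[y0 yk] := yP _ i Tt; have /andP[z0 zk] := yP _ i Tr.
have tr : Num.truncn (y eta i) = Num.truncn (y theta i).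
  have ub (u : R) : u <= k%:R -> 0 <= u -> (Num.truncn u < k.+1)%N.
    move=> uk u0; rewrite ltnS -(ler_nat R).
    by apply: le_trans uk; have /andP[] := truncn_itv u0.
  have /ffunP/(_ i) := cr; rewrite !ffunE => /(congr1 val) /=.
  by rewrite !inordK// ub.
have /andP[a1 a2] := truncn_itv y0; have /andP[b1 b2] := truncn_itv z0.
rewrite tr in b1 b2; move: a2 b2; rewrite -natr1 => a2 b2.
have -> : (theta - eta) 0 i = 2 * M / k%:R * (y theta i - y eta i).
  by rewrite !mxE /y; field; rewrite !gt_eqF.
rewrite normrM ger0_norm ?divr_ge0 ?mulr_ge0 ?(ltW M0)//.
apply: ler_piMr; first by rewrite divr_ge0// mulr_ge0// ltW.
by rewrite ler_norml; lra.
Qed.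

End Grid.

Lemma measure_bigsetU_le d (U : measurableType d) (R : realType)
    (m : {measure set U -> \bar R}) (I : Type) (s : seq I) (F : I -> set U) :
  (forall i, measurable (F i)) ->
  (m (\big[setU/set0]_(i <- s) F i) <= \sum_(i <- s) m (F i))%E.
Proof.
move=> mF; elim: s => [|j s ih]; first by rewrite !big_nil measure0.
rewrite !big_cons; apply: le_trans (measureU2 _ (mF j) _) _.
  exact: bigsetU_measurable.
exact: leeD.
Qed.

(** * Exponential bounds uniform in the parameter *)

Section UniformChernoff.
Context {dO dT : measure_display} {Omega : measurableType dO} {T : measurableType dT}.
Context {R : realType} {d : nat}.
Local Notation V := 'rV[R]_d.
Variables (P : probability Omega R) (X : nat -> {RV P >-> T}).
Variable Q : {measure set T -> \bar R}.
Hypothesis X_indep : mutually_independent X.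
Hypothesis X_law : forall i B, measurable B -> P (X i @^-1` B) = Q B.
Variables (Theta : set V) (vartheta : V) (M : R).
Hypotheses (M0 : 0 < M) (Theta_M : forall theta, Theta theta -> `|theta| <= M).
Hypothesis Theta_vartheta : Theta vartheta.
Variables (phi : V -> T -> R) (L c : R).
Hypotheses (L0 : 0 <= L) (c0 : 0 < c).
Hypothesis mphi : forall theta, Theta theta -> measurable_fun setT (phi theta).
Hypothesis phi_lip : forall theta eta x, Theta theta -> Theta eta ->
  `|phi theta x - phi eta x| <= L * `|theta - eta|.
Hypothesis phi_exp : forall theta, Theta theta -> exists2 e : R,
  (\int[Q]_x (expR (phi theta x))%:E = e%:E)%E &
  0 <= e <= expR (- (c * `|theta - vartheta| ^+ 2)).

(** At a grid point at distance [tau >= delta / 2] the threshold is half the exponent, so a bad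
    event has probability at most [exp (- n c tau^2 / 2) <= exp (- n c delta^2 / 8)]. A parameter at
    distance [t >= delta] has a neighbour with [tau >= t / 2]; the loss [n c t^2 / 8] there, less
    the oscillation [n c delta^2 / 16] within a cell, leaves [n c t^2 / 16]. *)
Lemma uniform_chernoff_fixed (n k : nat) (delta : R) : 0 < delta -> (0 < k)%N ->
  2 * M / k%:R <= delta / 2 -> L * (2 * M / k%:R) <= c * delta ^+ 2 / 16 ->
  exists E : set Omega, [/\ measurable E,
    (P (~` E) <= ((k.+1 ^ d)%:R * expR (- (c / 8 * (n%:R * delta ^+ 2))))%:E)%E &
    forall w, E w -> forall theta, Theta theta -> delta <= `|theta - vartheta| ->
      \sum_(i < n) phi theta (X i w) <= - (c / 16 * (n%:R * `|theta - vartheta| ^+ 2))].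
Proof.
move=> delta0 k0 mesh1 mesh2.
have [rep [Trep netP]] := exists_grid M0 Theta_M Theta_vartheta k0.
pose tau j := `|rep j - vartheta|.
pose bad j := if delta / 2 <= tau j then
  [set w | - (2^-1 * (n%:R * (c * tau j ^+ 2))) <= \sum_(i < n) phi (rep j) (X i w)] else set0.
have mbad j : measurable (bad j).
  rewrite /bad; case: ifP => // _.
  have ms : measurable_fun setT (fun w => \sum_(i < n) phi (rep j) (X i w)).
    by apply: measurable_sum => i; exact: (measurableT_comp (mphi (Trep j))).
  exact: measurable_superlevel.
exists (~` \big[setU/set0]_j bad j); split.
- by apply: measurableC; exact: bigsetU_measurable.
- rewrite setCK.
  have Pbad j : (P (bad j) <= (expR (- (c / 8 * (n%:R * delta ^+ 2))))%:E)%E.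
    rewrite /bad; case: ifPn => [dt|_]; last by rewrite measure0 lee_fin expR_ge0.
    have [e ee /andP[e0 eb]] := phi_exp (Trep j).
    apply: le_trans (chernoff X_indep X_law n _ (mphi (Trep j)) ee) _.
    rewrite lee_fin opprK.
    apply: (@le_trans _ _ (expR (2^-1 * (n%:R * (c * tau j ^+ 2))) *
        expR (- (c * tau j ^+ 2)) ^+ n)).
      by rewrite ler_wpM2l ?expR_ge0//; apply: lerXn2r; rewrite ?nnegrE ?expR_ge0.
    rewrite -expRM_natl -expRD ler_expR.
    have dt2 : delta ^+ 2 / 4 <= tau j ^+ 2.
      have := ltW delta0; have : 0 <= tau j by exact: normr_ge0.
      by move: dt; nra.
    have : 0 <= n%:R :> R by [].
    have h : n%:R * (c * (delta ^+ 2 / 4)) <= n%:R * (c * tau j ^+ 2).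
      by rewrite ler_wpM2l// ler_pM2l.
    lra.
  apply: (@le_trans _ _ (\sum_(j : {ffun 'I_d -> 'I_k.+1}) P (bad j))%E).
    exact: measure_bigsetU_le.
  apply: (@le_trans _ _ (\sum_(j : {ffun 'I_d -> 'I_k.+1})
     (expR (- (c / 8 * (n%:R * delta ^+ 2))))%:E)%E); first exact: lee_sum.
  rewrite sumEFin lee_fin big_const iter_addr_0 card_ffun !card_ord.
  by rewrite -[X in X <= _]mulr_natl.
- move=> w Ew theta Tt dt.
  have [j tj] := netP _ Tt.
  have tauj : `|theta - vartheta| / 2 <= tau j.
    have : `|theta - vartheta| <= `|theta - rep j| + tau j.
      by rewrite /tau; apply: le_trans (ler_normD _ _); rewrite subrKA.
    by move: mesh1 dt tj; lra.
  have nbad : \sum_(i < n) phi (rep j) (X i w) <= - (2^-1 * (n%:R * (c * tau j ^+ 2))).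
    rewrite leNgt; apply/negP => /ltW h; apply: Ew.
    rewrite (bigD1 j)//=; left; rewrite /bad ifT//; lra.
  have diff : \sum_(i < n) phi theta (X i w) <=
      \sum_(i < n) phi (rep j) (X i w) + n%:R * (c * delta ^+ 2 / 16).
    rewrite -lerBlDl -sumrB.
    apply: le_trans (_ : \sum_(i < n) (c * delta ^+ 2 / 16) <= _).
      apply: ler_sum => i _; apply: le_trans (ler_norm _) _.
      apply: le_trans (phi_lip _ Tt (Trep j)) _; apply: le_trans mesh2.
      exact: ler_wpM2l.
    by rewrite sumr_const card_ord mulr_natl.
  apply: le_trans diff _.
  have n0 : 0 <= n%:R :> R by [].
  have t0 : 0 <= `|theta - vartheta| by [].
  have t2 : `|theta - vartheta| ^+ 2 / 4 <= tau j ^+ 2 by nra.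
  have d2 : delta ^+ 2 <= `|theta - vartheta| ^+ 2 by nra.
  have h1 : n%:R * (c * (`|theta - vartheta| ^+ 2 / 4)) <= n%:R * (c * tau j ^+ 2).
    by rewrite ler_wpM2l// ler_pM2l.
  have h2 : n%:R * (c * delta ^+ 2) <= n%:R * (c * `|theta - vartheta| ^+ 2).
    by rewrite ler_wpM2l// ler_pM2l.
  lra.
Qed.

(* A union bound over a grid of mesh of order [1 / n] suffices: its cardinality is
   polynomial in [n] whereas each event fails with probability at most
   [exp (- c n^(1/3))]. *)
Lemma uniform_chernoff (eta0 : R) : 0 < eta0 ->
  with_probability_tending_to_1 P (fun n => [set w | forall theta, Theta theta ->
    eta0 <= `|theta - vartheta| * cbrt n ->
    \sum_(i < n) phi theta (X i w) <= - (c / 16 * (n%:R * `|theta - vartheta| ^+ 2))]).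
Proof.
move=> eta00.
(* The two bounds are the two mesh conditions for [delta = eta0 / cbrt n] and [k = K0 * n]; the
   added 1 makes [K0] positive. *)
pose K0 := (Num.bound (4 * M / eta0) + Num.bound (32 * M * L / (c * eta0 ^+ 2)) + 1)%N.
have K0pos : (0 < K0)%N by rewrite /K0 addn1.
have K1 : 4 * M / eta0 <= K0%:R.
  apply: le_trans (ltW (archi_boundP _)) _; first by rewrite divr_ge0 ?mulr_ge0// ltW.
  by rewrite ler_nat /K0 -addnA leq_addr.
have K2 : 32 * M * L / (c * eta0 ^+ 2) <= K0%:R.
  apply: le_trans (ltW (archi_boundP _)) _.
    by rewrite divr_ge0 ?mulr_ge0 ?exprn_ge0// ltW.
  by rewrite ler_nat /K0 addnAC leq_addl.
have fixed n : exists E : set Omega, measurable E /\ ((0 < n)%N ->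
    (P (~` E) <= (((K0 * n).+1 ^ d)%:R * expR (- (c / 8 * eta0 ^+ 2 * cbrt n)))%:E)%E /\
    E `<=` [set w | forall theta, Theta theta -> eta0 <= `|theta - vartheta| * cbrt n ->
    \sum_(i < n) phi theta (X i w) <= - (c / 16 * (n%:R * `|theta - vartheta| ^+ 2))]).
  have [->|n0] := posnP n; first by exists set0.
  have x1 : 1 <= cbrt n :> R.
    rewrite -(ler_pXn2r (isT : (0 < 3)%N)) ?nnegrE ?cbrt_ge0// cbrt3 expr1n.
    by rewrite ler1n.
  have x0 : 0 < cbrt n :> R by lra.
  have n0' : 0 < n%:R :> R by rewrite ltr0n.
  have K0' : 0 < K0%:R :> R by rewrite ltr0n.
  have n3 : n%:R = cbrt n ^+ 3 :> R by rewrite cbrt3.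
  have mesh1 : 2 * M / (K0 * n)%:R <= eta0 / cbrt n / 2.
    rewrite natrM n3 ler_pdivrMr ?mulr_gt0 ?exprn_gt0//.
    have -> : eta0 / cbrt n / 2 * (K0%:R * cbrt n ^+ 3) = K0%:R * eta0 / 2 * cbrt n ^+ 2.
      by field; rewrite gt_eqF.
    move: K1; rewrite ler_pdivrMr// => K1.
    apply: (@le_trans _ _ (K0%:R * eta0 / 2)); first lra.
    by rewrite ler_peMr ?exprn_ege1// divr_ge0// mulr_ge0// ltW.
  have mesh2 : L * (2 * M / (K0 * n)%:R) <= c * (eta0 / cbrt n) ^+ 2 / 16.
    rewrite mulrA natrM n3 ler_pdivrMr ?mulr_gt0 ?exprn_gt0//.
    have -> : c * (eta0 / cbrt n) ^+ 2 / 16 * (K0%:R * cbrt n ^+ 3) =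
      K0%:R * (c * eta0 ^+ 2) / 16 * cbrt n.
      by field; rewrite gt_eqF.
    move: K2; rewrite ler_pdivrMr ?mulr_gt0 ?exprn_gt0// => K2.
    apply: (@le_trans _ _ (K0%:R * (c * eta0 ^+ 2) / 16)); first lra.
    by rewrite ler_peMr// divr_ge0// !mulr_ge0 ?exprn_ge0// ltW.
  have Kn0 : (0 < K0 * n)%N by rewrite muln_gt0 K0pos.
  have [E [mE PE HE]] := uniform_chernoff_fixed n (divr_gt0 eta00 x0) Kn0 mesh1 mesh2.
  exists E; split => // _; split; last first.
    move=> w /HE h theta Tt dt; apply: h => //.
    by rewrite ler_pdivrMr.
  apply: le_trans PE _; rewrite lee_fin ler_wpM2l// ler_expR lerN2.
  rewrite le_eqVlt; apply/orP; left; apply/eqP; rewrite [in RHS]n3.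
  by field; rewrite gt_eqF.
have [E HE] := choice fixed.
apply: (@wpt1_of_bound _ _ _ _ _ E) => [n|e e0]; first by have [] := HE n.
have a0 : 0 < c / 8 * eta0 ^+ 2 by rewrite mulr_gt0 ?exprn_gt0// divr_gt0.
have [N HN] := poly_exp_decay K0 d a0 e0.
exists N.+1 => n Nn.
have [_] := HE n; case=> [|PE AE]; first by case: n Nn.
by split=> //; apply: le_trans PE _; rewrite lee_fin; apply: HN; exact: ltnW.
Qed.

End UniformChernoff.

(** * The likelihood and the rho-test near the maximum likelihood estimator *)

Section BoundedExpectation.
Context {dT : measure_display} {T : measurableType dT} {R : realType}.
Variable Q : probability T R.
Implicit Types (f g : T -> R) (K : R).

Lemma bounded_integrable f K : measurable_fun setT f -> (forall x, `|f x| <= K) ->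
  Q.-integrable setT (EFin \o f).
Proof.
move=> mf fK; apply: measurable_bounded_integrable => //.
  exact: fin_num_fun_lty.
exists K; split; first exact: num_real.
by move=> M KM x _; apply: le_trans (fK x) (ltW KM).
Qed.

Lemma le_expectation f g K K' : measurable_fun setT f -> measurable_fun setT g ->
  (forall x, `|f x| <= K) -> (forall x, `|g x| <= K') -> (forall x, f x <= g x) ->
  \int[Q]_x f x <= \int[Q]_x g x.
Proof.
by move=> mf mg fK gK fg; apply: le_Rintegral => //; [exact: bounded_integrable fK|exact: bounded_integrable gK].
Qed.

Lemma expectation_cst K : \int[Q]_x K = K.
Proof.
transitivity (K * fine (Q [set: T])); first exact: Rintegral_cst.
by rewrite probability_setT mulr1.
Qed.

Lemma expectation_norm_le f K : measurable_fun setT f -> (forall x, `|f x| <= K) ->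
  `|\int[Q]_x f x| <= K.
Proof.
move=> mf fK; rewrite ler_norml; apply/andP; split.
  rewrite -[leLHS]expectation_cst; apply: (@le_expectation _ _ `|- K| K) => // x.
  by have := fK x; rewrite ler_norml => /andP[].
rewrite -[leRHS]expectation_cst; apply: (@le_expectation _ _ K `|K|) => // x.
by have := fK x; rewrite ler_norml => /andP[].
Qed.

Lemma expectationB f g K K' : measurable_fun setT f -> measurable_fun setT g ->
  (forall x, `|f x| <= K) -> (forall x, `|g x| <= K') ->
  \int[Q]_x (f x - g x) = \int[Q]_x f x - \int[Q]_x g x.
Proof.
by move=> mf mg fK gK; apply: RintegralB => //; [exact: bounded_integrable fK|exact: bounded_integrable gK].
Qed.

Lemma expectationD f g K K' : measurable_fun setT f -> measurable_fun setT g ->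
  (forall x, `|f x| <= K) -> (forall x, `|g x| <= K') ->
  \int[Q]_x (f x + g x) = \int[Q]_x f x + \int[Q]_x g x.
Proof.
by move=> mf mg fK gK; apply: RintegralD => //; [exact: bounded_integrable fK|exact: bounded_integrable gK].
Qed.

Lemma expectationZ f K a : measurable_fun setT f -> (forall x, `|f x| <= K) ->
  \int[Q]_x (a * f x) = a * \int[Q]_x f x.
Proof. by move=> mf fK; apply: RintegralZl => //; exact: bounded_integrable fK. Qed.

Lemma EFin_expectation f K : measurable_fun setT f -> (forall x, `|f x| <= K) ->
  (\int[Q]_x (f x)%:E = (\int[Q]_x f x)%:E)%E.
Proof.
move=> mf fK; rewrite /Rintegral fineK//.
exact/integrable_fin_num/(bounded_integrable mf fK).
Qed.

End BoundedExpectation.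

Section MeasurableMeans.
Context {dT : measure_display} {T : measurableType dT} {R : realType}.
Implicit Types f g : T -> R.

Lemma measurable_sqrt f : measurable_fun setT f -> measurable_fun setT (fun x => Num.sqrt (f x)).
Proof.
move=> mf; apply: (measurableT_comp _ mf).
by apply: continuous_measurable_fun => x; exact: sqrt_continuous.
Qed.

Lemma measurable_qmean f g : measurable_fun setT f -> measurable_fun setT g ->
  measurable_fun setT (fun x => qmean (f x) (g x)).
Proof.
move=> mf mg; apply: measurable_sqrt; apply: measurable_funM => //.
by apply: measurable_funD; exact: measurable_funX.
Qed.

Lemma measurable_drift f g : measurable_fun setT f -> measurable_fun setT g ->
  measurable_fun setT (fun x => drift (f x) (g x)).
Proof.
by move=> mf mg; apply: measurable_funM; [exact: measurable_funB|exact: measurable_qmean].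
Qed.

Lemma measurable_score f g : measurable_fun setT f -> measurable_fun setT g ->
  (forall x, 0 < f x) -> (forall x, 0 < g x) ->
  measurable_fun setT (fun x => score (f x) (g x)).
Proof.
move=> mf mg f0 g0; apply: measurable_funM; first exact: measurable_funB.
have mq : measurable_fun setT (fun x => 2 * qmean (f x) (g x)).
  by apply: measurable_funM => //; exact: measurable_qmean.
rewrite (_ : (fun x => _) = (fun x => (2 * qmean (f x) (g x)) `^ -1)); last first.
  by apply/funext => x; rewrite powR_inv1// mulr_ge0// qmean_ge0.
exact: (measurableT_comp (measurable_powR _) mq).
Qed.

End MeasurableMeans.

(** * Abstract model: the ratios [W theta] under the law [Q] of one observation *)

Section Model.
Context {dO dT : measure_display} {Omega : measurableType dO} {T : measurableType dT}.
Context {R : realType} {d : nat}.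
Local Notation V := 'rV[R]_d.
Variables (P : probability Omega R) (X : nat -> {RV P >-> T}) (Q : probability T R).
Hypothesis X_indep : mutually_independent X.
Hypothesis X_law : forall i B, measurable B -> P (X i @^-1` B) = Q B.
Variables (Theta : set V) (vartheta : V) (M : R).
Hypotheses (M0 : 0 < M) (Theta_M : forall theta, Theta theta -> `|theta| <= M).
Hypothesis Theta_vartheta : Theta vartheta.
Variables (W : V -> T -> R) (A B c : R).
Hypotheses (A0 : 0 <= A) (B1 : 1 <= B) (c0 : 0 < c).
Hypothesis mW : forall theta, Theta theta -> measurable_fun setT (W theta).
Hypothesis WB : forall theta x, Theta theta -> B^-1 <= W theta x <= B.
Hypothesis W_lip : forall theta eta x, Theta theta -> Theta eta ->
  `|W theta x - W eta x| <= A * `|theta - eta|.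
Hypothesis W1 : forall x, W vartheta x = 1.
Hypothesis EW2 : forall theta, Theta theta -> \int[Q]_x (W theta x ^+ 2) = 1.
Hypothesis W_sep : forall theta, Theta theta ->
  c * `|theta - vartheta| ^+ 2 <= \int[Q]_x ((W theta x - 1) ^+ 2).

Let B0 : 0 < B. Proof. by move: B1; lra. Qed.
Let Bi0 : 0 < B^-1. Proof. by rewrite invr_gt0. Qed.

Lemma W_gt0 theta x : Theta theta -> 0 < W theta x.
Proof. by move=> /(WB x)/andP[+ _]; move: Bi0; lra. Qed.

Lemma W_norm theta x : Theta theta -> `|W theta x| <= B.
Proof. by move=> Tt; rewrite gtr0_norm ?W_gt0//; have /andP[] := WB x Tt. Qed.

Lemma W_sub1_norm theta x : Theta theta -> `|W theta x - 1| <= B.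
Proof.
move=> Tt; have /andP[w1 w2] := WB x Tt; rewrite ler_norml.
by have := W_gt0 x Tt; move: B1; lra.
Qed.

Let sqB (u K : R) : `|u| <= K -> `|u ^+ 2| <= K ^+ 2.
Proof. by move=> uK; rewrite normrX lerXn2r// nnegrE// (le_trans _ uK). Qed.

(* The value [1] of [W] in mean square makes [E W = 1 - h^2], a Hellinger affinity. *)
Lemma expectation_W theta : Theta theta ->
  \int[Q]_x W theta x = 1 - (\int[Q]_x ((W theta x - 1) ^+ 2)) / 2.
Proof.
move=> Tt; have mw := mW Tt.
have mw2 : measurable_fun setT (fun x => W theta x ^+ 2) by exact: measurable_funX.
have m2w : measurable_fun setT (fun x => 2 * W theta x) by exact: measurable_funM.
have b2w x : `|2 * W theta x| <= 2 * B.
  by rewrite normrM ger0_norm// ler_pM2l// W_norm.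
have -> : \int[Q]_x ((W theta x - 1) ^+ 2) =
    \int[Q]_x (W theta x ^+ 2 - (2 * W theta x - 1)).
  by apply: eq_Rintegral => x _; ring.
rewrite (@expectationB _ _ _ _ _ _ (B ^+ 2) (2 * B + 1))//; last 3 first.
- exact: measurable_funB.
- by move=> x; apply: sqB; exact: W_norm.
- by move=> x; apply: le_trans (ler_normB _ _) _; rewrite normr1 lerD2r.
rewrite (@expectationB _ _ _ _ _ _ (2 * B) 1)//; last by move=> x; rewrite normr1.
rewrite (@expectationZ _ _ _ _ _ B)//; last by move=> x; exact: W_norm.
by rewrite EW2// expectation_cst; field.
Qed.

(** The exponential moment of [ln W], half a log-likelihood ratio, is the affinity
    [E W = 1 - E (W - 1)^2 / 2], which separation bounds by [exp (- c / 2 |theta - vartheta|^2)]. *)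
Lemma loglik_whp (eta0 : R) : 0 < eta0 ->
  with_probability_tending_to_1 P (fun n => [set w | forall theta, Theta theta ->
    eta0 <= `|theta - vartheta| * cbrt n ->
    \sum_(i < n) ln (W theta (X i w)) <= - (c / 32 * (n%:R * `|theta - vartheta| ^+ 2))]).
Proof.
move=> eta00.
have -> : c / 32 = c / 2 / 16 by field.
apply: (@uniform_chernoff _ _ _ _ _ _ P X Q X_indep X_law Theta vartheta M M0
  Theta_M Theta_vartheta (fun theta x => ln (W theta x)) (B * A)) => //.
- by rewrite mulr_ge0// ltW.
- by rewrite divr_gt0.
- by move=> theta Tt; exact: (measurableT_comp (@measurable_ln R) (mW Tt)).
- move=> theta eta x Tt Te.
  have /andP[w1 _] := WB x Tt; have /andP[w2 _] := WB x Te.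
  apply: le_trans (ln_lipschitz B0 w1 w2) _.
  by rewrite -mulrA ler_pM2l// W_lip.
move=> theta Tt; exists (\int[Q]_x W theta x).
  rewrite -(@EFin_expectation _ _ _ Q _ B)//; [|exact: mW|by move=> x; exact: W_norm].
  by apply: eq_integral => x _; rewrite lnK// posrE W_gt0.
apply/andP; split.
  by apply: Rintegral_ge0 => x _; exact/ltW/W_gt0.
rewrite expectation_W//.
apply: (@le_trans _ _ (1 + - (c / 2 * `|theta - vartheta| ^+ 2))); last exact: expR_ge1Dx.
by have := W_sep Tt; lra.
Qed.

Definition mean_drift theta eta := \int[Q]_x drift (W theta x) (W eta x).

Let mdrift theta eta : Theta theta -> Theta eta ->
  measurable_fun setT (fun x => drift (W theta x) (W eta x)).
Proof. by move=> Tt Te; apply: measurable_drift; exact: mW. Qed.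

Let mscore theta eta : Theta theta -> Theta eta ->
  measurable_fun setT (fun x => score (W theta x) (W eta x)).
Proof. by move=> Tt Te; apply: measurable_score => [||x|x]; by [exact: mW|exact: W_gt0]. Qed.

Let W0B theta x : Theta theta -> 0 <= W theta x <= B.
Proof. by move=> Tt; rewrite ltW ?W_gt0//; have /andP[] := WB x Tt. Qed.

Lemma drift_norm theta eta x : Theta theta -> Theta eta ->
  `|drift (W theta x) (W eta x)| <= B ^+ 2.
Proof.
move=> Tt Te; rewrite normrM expr2; apply: ler_pM => //.
  by rewrite ler_norml; have := W0B x Tt; have := W0B x Te; lra.
by rewrite ger0_norm ?qmean_ge0// qmean_le_max// W0B.
Qed.

Lemma mean_drift_opp theta eta : Theta theta -> Theta eta ->
  mean_drift theta eta = - mean_drift eta theta.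
Proof.
move=> Tt Te; rewrite -mulN1r -(@expectationZ _ _ _ _ _ (B ^+ 2)).
- by apply: eq_Rintegral => x _; rewrite mulN1r drift_opp.
- exact: mdrift.
- by move=> x; exact: drift_norm.
Qed.

Lemma mean_drift_lip theta theta' eta : Theta theta -> Theta theta' -> Theta eta ->
  `|mean_drift theta eta - mean_drift theta' eta| <= 2 * B * A * `|theta - theta'|.
Proof.
move=> Tt Tt' Te; rewrite -(@expectationB _ _ _ _ _ _ (B ^+ 2) (B ^+ 2)); last 4 first.
- exact: mdrift.
- exact: mdrift.
- by move=> x; exact: drift_norm.
- by move=> x; exact: drift_norm.
apply: expectation_norm_le => [|x]; first by apply: measurable_funB; exact: mdrift.
apply: le_trans (drift_lipschitz (W0B x Tt) (W0B x Tt') (W0B x Te)) _.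
by rewrite -[leRHS]mulrA ler_pM2l ?mulr_gt0// W_lip.
Qed.

Lemma score_W_lip theta theta' eta x : Theta theta -> Theta theta' -> Theta eta ->
  `|score (W theta x) (W eta x) - score (W theta' x) (W eta x)| <=
  B ^+ 3 * A * `|theta - theta'|.
Proof.
move=> Tt Tt' Te; apply: le_trans (score_lipschitz B1 (WB x Tt) (WB x Tt') (WB x Te)) _.
by rewrite -[leRHS]mulrA ler_pM2l ?exprn_gt0// W_lip.
Qed.

(** All the [W ^+ 2] have mean 1, so half the difference of squares can be subtracted from the
    drift, and the cubic remainder has one factor bounded by [K]. Keeping [K] apart allows two uses:
    [K = B] bounds the mean drift by a squared Hellinger distance, and [K = A |eta - theta|] makes
    it cubic in the parameter. *)
Lemma mean_drift_cubic theta eta (K : R) : Theta theta -> Theta eta -> 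
  (forall x, `|W eta x - W theta x| <= K) ->
  `|mean_drift theta eta| <= B * K * \int[Q]_x ((W eta x - W theta x) ^+ 2).
Proof.
move=> Tt Te WK.
have mt := mW Tt; have me := mW Te.
have m2 : measurable_fun setT (fun x => (W eta x ^+ 2 - W theta x ^+ 2)).
  by apply: measurable_funB; exact: measurable_funX.
have b2 x : `|W eta x ^+ 2 - W theta x ^+ 2| <= 2 * B ^+ 2.
  apply: le_trans (ler_normB _ _) _; rewrite mulr_natl mulr2n.
  by apply: lerD; apply: sqB; exact: W_norm.
have E0 : \int[Q]_x (2^-1 * (W eta x ^+ 2 - W theta x ^+ 2)) = 0.
  rewrite (@expectationZ _ _ _ _ _ (2 * B ^+ 2))//.
  rewrite (@expectationB _ _ _ _ _ _ (B ^+ 2) (B ^+ 2)); last 4 first.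
  - exact: measurable_funX.
  - exact: measurable_funX.
  - by move=> x; apply: sqB; exact: W_norm.
  - by move=> x; apply: sqB; exact: W_norm.
  by rewrite !EW2// subrr mulr0.
have mh : measurable_fun setT (fun x => 2^-1 * (W eta x ^+ 2 - W theta x ^+ 2)).
  exact: measurable_funM.
have bh x : `|2^-1 * (W eta x ^+ 2 - W theta x ^+ 2)| <= B ^+ 2.
  by rewrite normrM ger0_norm// ler_pdivrMl// b2.
have msq : measurable_fun setT (fun x => (W eta x - W theta x) ^+ 2).
  by apply: measurable_funX; exact: measurable_funB.
have bsq x : `|(W eta x - W theta x) ^+ 2| <= K ^+ 2 by exact: (sqB (WK x)).
have mBK : measurable_fun setT (fun x => B * K * (W eta x - W theta x) ^+ 2).
  exact: measurable_funM.
have K0 : 0 <= K by apply: le_trans (WK point).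
have bBK x : `|B * K * (W eta x - W theta x) ^+ 2| <= B * K * K ^+ 2.
  rewrite normrM (@ger0_norm _ (B * K)) ?mulr_ge0// ?(ltW B0)//.
  by rewrite ler_wpM2l// mulr_ge0// ltW.
have key x : `|drift (W theta x) (W eta x) - 2^-1 * (W eta x ^+ 2 - W theta x ^+ 2)| <=
    B * K * (W eta x - W theta x) ^+ 2.
  have /andP[w1 _] := WB x Tt; have /andP[w2 _] := WB x Te.
  rewrite mulrC; apply: le_trans (drift_cubic B0 w1 w2) _.
  rewrite exprS -mulrA ler_pM2l// real_normK ?num_real//.
  by rewrite ler_wpM2r// sqr_ge0.
have md := mdrift Tt Te.
have bd x := drift_norm x Tt Te.
have -> : mean_drift theta eta = \int[Q]_x (drift (W theta x) (W eta x) -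
    2^-1 * (W eta x ^+ 2 - W theta x ^+ 2)).
  by rewrite (@expectationB _ _ _ _ _ _ (B ^+ 2) (B ^+ 2))// E0 subr0.
have mdd := measurable_funB md mh.
have bdd x : `|drift (W theta x) (W eta x) - 2^-1 * (W eta x ^+ 2 - W theta x ^+ 2)| <= B * K * K ^+ 2.
  apply: le_trans (key x) _; apply: le_trans (bBK x); exact: ler_norm.
rewrite -(@expectationZ _ _ _ _ _ (K ^+ 2))// ler_norml; apply/andP; split.
  rewrite lerNl -mulN1r -(@expectationZ _ _ _ _ _ (B * K * K ^+ 2))//.
  apply: (@le_expectation _ _ _ _ _ _ (B * K * K ^+ 2) (B * K * K ^+ 2)) => //.
  - exact: measurable_funM.
  - by move=> x; rewrite mulN1r normrN.
  - by move=> x; rewrite mulN1r lerNl; have := key x; rewrite ler_norml => /andP[].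
apply: (@le_expectation _ _ _ _ _ _ (B * K * K ^+ 2) (B * K * K ^+ 2)) => // x.
by apply: le_trans (key x); exact: ler_norm.
Qed.

Lemma sum_cst_ord n (a : R) : \sum_(i < n) a = n%:R * a.
Proof. by rewrite sumr_const card_ord mulr_natl. Qed.

(** [rho_T] in terms of [W] alone; [rho_T_eq] links the two. *)
Definition rho_test theta eta n (x : 'I_n -> T) :=
  n%:R / 2 * mean_drift theta eta + \sum_(i < n) score (W theta (x i)) (W eta (x i)).

Lemma score1_sqr (w : R) : 0 < w -> score 1 w ^+ 2 <= (w - 1) ^+ 2.
Proof.
move=> w0; rewrite /score.
have q1 : 1 <= 2 * qmean 1 w by have := qmean_ge_mean 1 w; lra.
have q0 : 0 < 2 * qmean 1 w by lra.
rewrite expr_div_n ler_pdivrMr ?exprn_gt0// ler_peMr ?sqr_ge0//.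
by rewrite exprn_ege1.
Qed.

(** The contribution [z] of one observation, scaled by a small [lam], has exponential moment at most
    [1 + E z + 2 E z^2]. The mean is at most [- lam H / 30] by [score_drift_le], whereas the second
    moment is of order [lam^2 H]. *)
Lemma rho_test_true_whp (eta0 : R) : 0 < eta0 ->
  with_probability_tending_to_1 P (fun n => [set w | forall theta, Theta theta ->
    eta0 <= `|theta - vartheta| * cbrt n ->
    rho_test vartheta theta (sample X n w) <= - (c / 960 * (n%:R * `|theta - vartheta| ^+ 2))]).
Proof.
move=> eta00.
(* Small enough for [|z| <= 1 / 2] and, with [D] the mean drift, for the quadratic terms [lam^2 D^2]
   and [4 lam^2 H] to take at most [5 lam H / 480] of the gain [lam H / 30]; more than [lam H / 60]
   remains. *)
pose lam : R := (480 * B ^+ 6)^-1.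
have B6 : 1 <= B ^+ 6 by rewrite exprn_ege1.
have lam0 : 0 < lam by rewrite invr_gt0; lra.
have lamE : lam * B ^+ 6 = 480^-1 by rewrite /lam; field; rewrite gt_eqF.
pose z theta x := lam * (score 1 (W theta x) + mean_drift vartheta theta / 2).
pose H theta := \int[Q]_x ((W theta x - 1) ^+ 2).
have Bn (k : nat) : (k <= 6)%N -> B ^+ k <= B ^+ 6.
  by move=> k6; apply: ler_weXn2l.
have D1 theta : Theta theta -> `|mean_drift vartheta theta| <= B ^+ 2 * H theta.
  move=> Tt; apply: le_trans (@mean_drift_cubic vartheta theta B _ _ _) _ => //.
    by move=> x; rewrite W1 W_sub1_norm.
  by rewrite -expr2 /H; under eq_Rintegral do rewrite W1.
have H0 theta : 0 <= H theta by apply: Rintegral_ge0 => x _; exact: sqr_ge0.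
have msq theta : Theta theta -> measurable_fun setT (fun x => (W theta x - 1) ^+ 2).
  by move=> Tt; apply: measurable_funX; apply: measurable_funB => //; exact: mW.
have bsq theta x : Theta theta -> `|(W theta x - 1) ^+ 2| <= B ^+ 2.
  by move=> Tt; apply: sqB; exact: W_sub1_norm.
have HB theta : Theta theta -> H theta <= B ^+ 2.
  move=> Tt; apply: le_trans (ler_norm _) _; apply: expectation_norm_le; first exact: msq.
  by move=> x; exact: bsq.
have D2 theta : Theta theta -> `|mean_drift vartheta theta| <= B ^+ 4.
  move=> Tt; apply: le_trans (D1 _ Tt) _; rewrite (exprD B 2 2).
  by rewrite ler_wpM2l ?exprn_ge0 ?(ltW B0)// HB.
have ms theta : Theta theta -> measurable_fun setT (fun x => score 1 (W theta x)).
  by move=> Tt; have := mscore Theta_vartheta Tt; under eq_fun do rewrite W1.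
have mz theta : Theta theta -> measurable_fun setT (z theta).
  by move=> Tt; apply: measurable_funM => //; apply: measurable_funD => //; exact: ms.
have bs theta x : Theta theta -> `|score 1 (W theta x)| <= B.
  move=> Tt; rewrite -(ler_pXn2r (isT : (0 < 2)%N)) ?nnegrE ?(ltW B0)//.
  rewrite real_normK ?num_real//; apply: le_trans (score1_sqr (W_gt0 x Tt)) _.
  by apply: le_trans (bsq _ x Tt); exact: ler_norm.
have bz theta x : Theta theta -> `|z theta x| <= 2^-1.
  move=> Tt; rewrite /z normrM gtr0_norm//.
  apply: (@le_trans _ _ (lam * (2 * B ^+ 6))); last by rewrite mulrCA lamE; lra.
  rewrite ler_pM2l//; apply: le_trans (ler_normD _ _) _.
  have := bs _ x Tt; have := D2 _ Tt; have := Bn 4%N isT; have := Bn 1%N isT.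
  rewrite expr1 (normrM (mean_drift _ _)) (@ger0_norm _ 2^-1)//.
  by have : 0 <= `|mean_drift vartheta theta| by []; lra.
have -> : (fun n => [set w | forall theta, Theta theta ->
    eta0 <= `|theta - vartheta| * cbrt n ->
    rho_test vartheta theta (sample X n w) <= - (c / 960 * (n%:R * `|theta - vartheta| ^+ 2))]) =
  (fun n => [set w | forall theta, Theta theta ->
    eta0 <= `|theta - vartheta| * cbrt n ->
    \sum_(i < n) z theta (X i w) <= - (lam * c / 60 / 16 * (n%:R * `|theta - vartheta| ^+ 2))]).
  apply/funext => n; apply/funext => w /=; apply/propext.
  have E theta : \sum_(i < n) z theta (X i w) = lam * rho_test vartheta theta (sample X n w).
    rewrite -mulr_sumr big_split/= sum_cst_ord /rho_test addrC.
    congr (_ * (_ + _)); first by field.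
    by apply: eq_bigr => i _; rewrite W1.
  have E2 theta : - (lam * c / 60 / 16 * (n%:R * `|theta - vartheta| ^+ 2)) =
      lam * (- (c / 960 * (n%:R * `|theta - vartheta| ^+ 2))) by field.
  by split => h theta Tt /(h _ Tt); rewrite E E2 ler_pM2l.
apply: (@uniform_chernoff _ _ _ _ _ _ P X Q X_indep X_law Theta vartheta M M0
  Theta_M Theta_vartheta z (lam * (B ^+ 3 * A + B * A))) => //.
- by rewrite mulr_ge0 ?addr_ge0 ?mulr_ge0 ?exprn_ge0// ltW.
- by rewrite divr_gt0// mulr_gt0.
- move=> theta eta x Tt Te; rewrite /z -mulrBr normrM gtr0_norm// -mulrA ler_pM2l//.
  (* The Lipschitz bounds vary the first argument; antisymmetry brings [theta] and [eta] there. *)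
  have -> : score 1 (W theta x) + mean_drift vartheta theta / 2 -
      (score 1 (W eta x) + mean_drift vartheta eta / 2) =
     (score (W eta x) (W vartheta x) - score (W theta x) (W vartheta x)) +
     (mean_drift eta vartheta - mean_drift theta vartheta) / 2.
    rewrite W1 (score_opp 1 (W theta x)) (score_opp 1 (W eta x)).
    by rewrite (mean_drift_opp Theta_vartheta Tt) (mean_drift_opp Theta_vartheta Te); field.
  apply: le_trans (ler_normD _ _) _; rewrite [leRHS]mulrDl; apply: lerD.
    by rewrite distrC; exact: score_W_lip.
  rewrite normrM (@ger0_norm _ 2^-1)// ler_pdivrMr// distrC.
  by apply: le_trans (mean_drift_lip Tt Te Theta_vartheta) _; lra.
move=> theta Tt; exists (\int[Q]_x expR (z theta x)).
  rewrite -(@EFin_expectation _ _ _ Q _ (expR 2^-1))//.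
    by apply: (measurableT_comp _ (mz _ Tt)); exact: measurable_expR.
  move=> x; rewrite ger0_norm ?expR_ge0// ler_expR.
  by apply: le_trans (bz _ x Tt); exact: ler_norm.
have eint : \int[Q]_x expR (z theta x) <= 1 - lam * H theta / 60.
  have bW2 x : `|W theta x ^+ 2| <= B ^+ 2 by apply: sqB; exact: W_norm.
  have mW2 : measurable_fun setT (fun x => W theta x ^+ 2) by apply: measurable_funX; exact: mW.
  have md : measurable_fun setT (fun x => drift 1 (W theta x)).
    by have := mdrift Theta_vartheta Tt; under eq_fun do rewrite W1.
  have bd x : `|drift 1 (W theta x)| <= B ^+ 2.
    by have := drift_norm x Theta_vartheta Tt; rewrite W1.
  set D := mean_drift vartheta theta.
  have DE : \int[Q]_x drift 1 (W theta x) = D.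
    by rewrite /D /mean_drift; under [RHS]eq_Rintegral do rewrite W1.
  (* The majorant [G] of [expR (z theta x)] combines [score_drift_le] with [(score + D / 2)^2 <= 2
     (w - 1)^2 + D^2 / 2]. Its drift term has mean [- lam D / 2], which cancels the [lam D / 2] of
     [k1]. *)
  pose nu := lam / 30 - 4 * lam ^+ 2.
  pose k1 := 1 + lam * D / 2 + lam ^+ 2 * D ^+ 2 - lam / 2.
  pose G x := (k1 + lam / 2 * W theta x ^+ 2) -
    (lam / 2 * drift 1 (W theta x) + nu * (W theta x - 1) ^+ 2).
  have m1 : measurable_fun setT (fun x => lam / 2 * W theta x ^+ 2) by exact: measurable_funM.
  have m2 : measurable_fun setT (fun x => lam / 2 * drift 1 (W theta x)) by exact: measurable_funM.
  have m3 : measurable_fun setT (fun x => nu * (W theta x - 1) ^+ 2).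
    by apply: measurable_funM => //; exact: msq.
  have m4 : measurable_fun setT (fun x => k1 + lam / 2 * W theta x ^+ 2) by exact: measurable_funD.
  have m5 : measurable_fun setT
      (fun x => lam / 2 * drift 1 (W theta x) + nu * (W theta x - 1) ^+ 2).
    exact: measurable_funD.
  have b1 x : `|lam / 2 * W theta x ^+ 2| <= lam / 2 * B ^+ 2.
    by rewrite normrM gtr0_norm ?divr_gt0// ler_pM2l// divr_gt0.
  have b2 x : `|lam / 2 * drift 1 (W theta x)| <= lam / 2 * B ^+ 2.
    by rewrite normrM gtr0_norm ?divr_gt0// ler_pM2l// divr_gt0.
  have b3 x : `|nu * (W theta x - 1) ^+ 2| <= `|nu| * B ^+ 2.
    by rewrite normrM ler_wpM2l// bsq.
  have b4 x : `|k1 + lam / 2 * W theta x ^+ 2| <= `|k1| + lam / 2 * B ^+ 2.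
    by apply: le_trans (ler_normD _ _) _; rewrite lerD2l.
  have b5 x : `|lam / 2 * drift 1 (W theta x) + nu * (W theta x - 1) ^+ 2| <=
      lam / 2 * B ^+ 2 + `|nu| * B ^+ 2.
    by apply: le_trans (ler_normD _ _) _; exact: lerD.
  have EG : \int[Q]_x G x = k1 + lam / 2 - (lam / 2 * D + nu * H theta).
    rewrite /G (expectationB _ m4 m5 b4 b5).
    rewrite (@expectationD _ _ _ _ (cst k1) _ _ _ (measurable_cst k1) m1 (fun=> lexx `|k1|) b1).
    rewrite (expectationD _ m2 m3 b2 b3) expectation_cst.
    rewrite (expectationZ _ _ mW2 bW2) EW2// mulr1.
    rewrite (expectationZ _ _ md bd) DE.
    by rewrite (expectationZ _ _ (msq _ Tt) (fun x => bsq _ x Tt)).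
  have eG x : expR (z theta x) <= G x.
    apply: le_trans (expR_le_quad (bz _ x Tt)) _.
    have s2 := score1_sqr (W_gt0 x Tt); have sd := score_drift_le (W_gt0 x Tt).
    rewrite /z /G -/D /k1 /nu; set sc := score 1 _ in s2 sd *; set w := W theta x in s2 sd *.
    set dr := drift 1 w in sd *.
    have h1 : lam * (sc + dr / 2) <= lam * ((w ^+ 2 - 1) / 2 - (w - 1) ^+ 2 / 30).
      by rewrite ler_pM2l.
    have h2 : lam ^+ 2 * (sc + D / 2) ^+ 2 <= lam ^+ 2 * (2 * (w - 1) ^+ 2 + D ^+ 2 / 2).
      rewrite ler_pM2l ?exprn_gt0//.
      by have := sqr_ge0 (sc - D / 2); lra.
    rewrite exprMn; lra.
  have mG : measurable_fun setT G by exact: measurable_funB.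
  have bG x : `|G x| <= `|k1| + lam / 2 * B ^+ 2 + (lam / 2 * B ^+ 2 + `|nu| * B ^+ 2).
    by apply: le_trans (ler_normB _ _) _; exact: lerD.
  have mez : measurable_fun setT (fun x => expR (z theta x)).
    by apply: (measurableT_comp _ (mz _ Tt)); exact: measurable_expR.
  have bez x : `|expR (z theta x)| <= expR 2^-1.
    rewrite ger0_norm ?expR_ge0// ler_expR.
    by apply: le_trans (bz _ x Tt); exact: ler_norm.
  apply: le_trans (le_expectation _ mez mG bez bG eG) _; rewrite EG.
  have D2H : D ^+ 2 <= B ^+ 6 * H theta.
    have h := D1 _ Tt; have h' := D2 _ Tt.
    rewrite -(real_normK (num_real D)) expr2 (_ : B ^+ 6 * H theta = B ^+ 4 * (B ^+ 2 * H theta)).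
      by apply: ler_pM.
    by rewrite mulrA -exprD.
  have lam2 : lam <= 480^-1 by rewrite -lamE ler_peMr// ltW.
  have h1 : lam ^+ 2 * D ^+ 2 <= lam * H theta / 480.
    apply: (@le_trans _ _ (lam ^+ 2 * (B ^+ 6 * H theta))).
      by rewrite ler_wpM2l// exprn_ge0// ltW.
    have -> : lam ^+ 2 * (B ^+ 6 * H theta) = lam * H theta * (lam * B ^+ 6) by ring.
    by rewrite lamE.
  have h2 : lam ^+ 2 * H theta <= lam * H theta / 480.
    have -> : lam ^+ 2 * H theta = lam * H theta * lam by ring.
    by rewrite ler_wpM2l// mulr_ge0// ltW.
  have : 0 <= lam * H theta by rewrite mulr_ge0// ltW.
  by rewrite /k1 /nu; lra.
apply/andP; split.
  by apply: Rintegral_ge0 => x _; exact: expR_ge0.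
apply: le_trans eint _.
apply: (@le_trans _ _ (1 + - (lam * c / 60 * `|theta - vartheta| ^+ 2))); last exact: expR_ge1Dx.
have : lam * (c * `|theta - vartheta| ^+ 2) <= lam * H theta by rewrite ler_pM2l// W_sep.
lra.
Qed.

Lemma rho_test_lip theta theta' eta n (x : 'I_n -> T) :
  Theta theta -> Theta theta' -> Theta eta ->
  rho_test theta eta x <= rho_test theta' eta x +
    n%:R * ((B * A + B ^+ 3 * A) * `|theta - theta'|).
Proof.
move=> Tt Tt' Te; rewrite -lerBlDl /rho_test.
set S1 := \sum_(i < n) _; set S2 := \sum_(i < n) _.
have hS : S1 - S2 <= n%:R * (B ^+ 3 * A * `|theta - theta'|).
  rewrite -sumrB -sum_cst_ord; apply: ler_sum => i _.
  by apply: le_trans (ler_norm _) _; exact: score_W_lip.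
have hD : n%:R / 2 * (mean_drift theta eta - mean_drift theta' eta) <=
    n%:R / 2 * (2 * B * A * `|theta - theta'|).
  rewrite ler_wpM2l ?divr_ge0//.
  by apply: le_trans (ler_norm _) _; exact: mean_drift_lip.
lra.
Qed.

(** The first term comes from the mean drift, with its factor 1/2 in the test. The second comes from
    [score_le_ln] with [K = B ^+ 2], a ratio of two [W] differing from 1 by at most
    [B A |eta - theta|]. *)
Definition cubic_const := B * A ^+ 3 / 2 + B ^+ 2 * (B * A) ^+ 3.

Lemma cubic_const_ge0 : 0 <= cubic_const.
Proof.
by rewrite addr_ge0// ?divr_ge0// mulr_ge0 ?exprn_ge0// ?mulr_ge0// ltW.
Qed.

Lemma rho_test_le_loglik theta eta n (x : 'I_n -> T) : Theta theta -> Theta eta ->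
  rho_test theta eta x <=
    2^-1 * (\sum_(i < n) ln (W eta (x i)) - \sum_(i < n) ln (W theta (x i)))
    + n%:R * (cubic_const * `|eta - theta| ^+ 3).
Proof.
move=> Tt Te; rewrite /rho_test.
have hD : n%:R / 2 * mean_drift theta eta <= n%:R / 2 * (B * A ^+ 3 * `|eta - theta| ^+ 3).
  rewrite ler_wpM2l ?divr_ge0//.
  apply: le_trans (ler_norm _) _.
  have K0 : 0 <= A * `|eta - theta| by rewrite mulr_ge0.
  apply: le_trans (mean_drift_cubic Tt Te (fun x => W_lip x Te Tt)) _.
  rewrite -[leRHS]mulrA -exprMn -[leLHS]mulrA ler_pM2l// [leRHS]exprS ler_wpM2l//.
  apply: le_trans (ler_norm _) _; apply: expectation_norm_le => [|y].
    by apply: measurable_funX; apply: measurable_funB; exact: mW.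
  by apply: sqB; exact: W_lip.
have hS : \sum_(i < n) score (W theta (x i)) (W eta (x i)) <=
    2^-1 * (\sum_(i < n) ln (W eta (x i)) - \sum_(i < n) ln (W theta (x i)))
    + n%:R * (B ^+ 2 * (B * A * `|eta - theta|) ^+ 3).
  rewrite -sumrB mulr_sumr -sum_cst_ord -big_split/=; apply: ler_sum => i _.
  have wt := W_gt0 (x i) Tt; have we := W_gt0 (x i) Te.
  have /andP[t1 t2] := WB (x i) Tt; have /andP[e1 e2] := WB (x i) Te.
  have B21 : 1 <= B ^+ 2 by rewrite exprn_ege1.
  apply: le_trans (@score_le_ln _ _ _ (B ^+ 2) wt we B21 _) _.
    rewrite ler_pdivlMr//; apply: le_trans e1.
    rewrite -exprVn expr2 -mulrA; apply: ler_piMr; first exact: ltW.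
    by rewrite mulrC ler_pdivrMr// mul1r.
  rewrite lerD2l ler_pM2l ?exprn_gt0//; apply: lerXn2r; rewrite ?nnegrE//.
    by rewrite !mulr_ge0// ltW.
  have -> : W eta (x i) / W theta (x i) - 1 = (W eta (x i) - W theta (x i)) / W theta (x i).
    by field; rewrite gt_eqF.
  rewrite normrM normfV (gtr0_norm wt) ler_pdivrMr//.
  apply: (@le_trans _ _ (A * `|eta - theta|)); first exact: W_lip.
  rewrite -(mulrA B) (mulrC B) -[leRHS]mulrA; apply: ler_peMr; first by rewrite mulr_ge0.
  by rewrite mulrC -ler_pdivrMr// div1r.
apply: le_trans (lerD hD hS) _.
rewrite addrCA lerD2l /cubic_const exprMn; lra.
Qed.

(* With [u] the distance from [theta] to the MLE [hat]: for [u] of order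
   [n^(-1/3)] the cubic error is bounded; for [u < delta0] it is dominated by the
   quadratic loss of log-likelihood; for larger [u] the test is compared with the
   one based on the true parameter. *)
Lemma mle_rho_test_whp : with_probability_tending_to_1 P (fun n =>
  [set w | forall hat, Theta hat ->
    (forall theta, Theta theta ->
      \sum_(i < n) ln (W theta (X i w)) <= \sum_(i < n) ln (W hat (X i w))) ->
    forall theta, Theta theta -> rho_test hat theta (sample X n w) <= 8]).
Proof.
have C0 := cubic_const_ge0; set C := cubic_const in C0.
(* Both [eta0] and [C eta0] are at most 1, so that [C (2 eta0)^3 <= 8]. *)
pose eta0 := (1 + C)^-1.
have eta00 : 0 < eta0 by rewrite invr_gt0; lra.
have eta01 : eta0 <= 1 by rewrite invf_le1; lra.
have Ceta0 : C * eta0 <= 1 by rewrite ler_pdivrMr; lra.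
pose a := c / 32; have a0 : 0 < a by rewrite divr_gt0.
have [a2 a2E a20] : exists2 a2, a2 = c / 960 & 0 < a2.
  by exists (c / 960); [reflexivity|move: c0; lra].
(* Half of the loss [a t^2], where [t >= u / 2], is at least [a u^2 / 8]; below [delta0] this covers
   the cubic error [C u^3]. *)
have [delta0 delta00 Cdelta0] : exists2 delta0, 0 < delta0 & C * delta0 <= a / 8.
  exists (a / (8 * (C + 1))); first by rewrite divr_gt0// mulr_gt0//; lra.
  rewrite mulrA ler_pdivrMr; last lra.
  by nra.
pose C2 := B * A + B ^+ 3 * A.
have C20 : 0 <= C2 by rewrite addr_ge0// mulr_ge0 ?exprn_ge0// ltW.
(* Replacing the MLE by [vartheta] in the test costs [n C2 v]; as [v < eta0 / cbrt n], this is at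
   most [n a2 delta0^2 / 4] from [N] on. *)
have [N HN] := @cbrt_ge R (Num.max 1 (4 * C2 * eta0 / (a2 * delta0 ^+ 2))).
apply: (@wpt1_impl2 _ _ _ P _ _ _ N _ (loglik_whp eta00) (rho_test_true_whp eta00)).
move=> n /HN; rewrite ge_max => /andP[x1 xC2] w [/= hlog htest] hat That hmle theta Tt.
set x := cbrt n in x1 xC2 hlog htest.
have x0 : 0 < x by lra.
have n3 : n%:R = x ^+ 3 by rewrite cbrt3.
have n0 : 0 < n%:R :> R by rewrite n3 exprn_gt0.
set v := `|hat - vartheta|; set u := `|theta - hat|; set t := `|theta - vartheta|.
have v0 : 0 <= v := normr_ge0 _. have u0 : 0 <= u := normr_ge0 _.
have t0 : 0 <= t := normr_ge0 _.
have utv : u <= t + v.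
  by rewrite /v distrC; apply: le_trans (ler_normD _ _); rewrite subrKA.
have ln0 : \sum_(i < n) ln (W vartheta (X i w)) = 0.
  by rewrite big1// => i _; rewrite W1 ln1.
have hat0 : 0 <= \sum_(i < n) ln (W hat (X i w)) by have := hmle _ Theta_vartheta; rewrite ln0.
(* Further away the log-likelihood ratio would be negative at [hat], whereas a maximizer does at
   least as well as [vartheta], whose value is 0. *)
have vx : v * x < eta0.
  rewrite ltNge; apply/negP => h; have := hlog _ That h; rewrite -/v -/a => h'.
  have v00 : 0 < v by rewrite -(pmulr_lgt0 _ x0) mulrC (lt_le_trans eta00)// mulrC.
  have : 0 < a * (n%:R * v ^+ 2) by rewrite !mulr_gt0// exprn_gt0.
  lra.
have hcub := rho_test_le_loglik (sample X n w) That Tt; rewrite -/C -/u in hcub.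
have [ux|ux] := leP (u * x) (2 * eta0).
  apply: le_trans hcub _.
  have h1 : 2^-1 * (\sum_(i < n) ln (W theta (sample X n w i)) -
      \sum_(i < n) ln (W hat (sample X n w i))) <= 0.
    by have := hmle _ Tt; rewrite /sample; lra.
  have h2 : n%:R * (C * u ^+ 3) <= 8.
    rewrite n3 mulrCA -exprMn (mulrC x).
    apply: (@le_trans _ _ (C * (2 * eta0) ^+ 3)).
      rewrite ler_wpM2l//; apply: lerXn2r; rewrite ?nnegrE// ?mulr_ge0// ltW//.
    have -> : C * (2 * eta0) ^+ 3 = 8 * ((C * eta0) * (eta0 * eta0)) by ring.
    rewrite -[leRHS]mulr1 ler_pM2l//.
    have e2 : eta0 * eta0 <= 1 by rewrite mulr_ile1// ltW.
    by rewrite mulr_ile1// ?mulr_ge0// ltW.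
  lra.
(* Here [u] exceeds twice the bound [eta0 / x] on [v], so [t >= u / 2], and [theta] is far enough
   from [vartheta] for both uniform bounds. *)
have vu : v <= u / 2 by rewrite -(ler_pM2r x0); lra.
have ut : u / 2 <= t by lra.
have tx : eta0 <= t * x by have := ler_wpM2r (ltW x0) ut; lra.
have t2 : u ^+ 2 / 4 <= t ^+ 2.
  have -> : u ^+ 2 / 4 = (u / 2) ^+ 2 by field.
  by apply: lerXn2r; rewrite ?nnegrE// divr_ge0.
apply: (@le_trans _ _ 0) => //.
have [ud|ud] := leP u delta0.
  apply: le_trans hcub _.
  have h1 := hlog _ Tt tx; rewrite -/t -/a in h1.
  have h2 : n%:R * (a * (u ^+ 2 / 4)) <= n%:R * (a * t ^+ 2).
    by rewrite ler_pM2l// ler_pM2l.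
  have h3 : n%:R * (C * u ^+ 3) <= n%:R * (a / 8 * u ^+ 2).
    rewrite ler_pM2l// exprS mulrA; apply: ler_wpM2r; first exact: sqr_ge0.
    by apply: le_trans Cdelta0; exact: ler_wpM2l.
  rewrite /sample; lra.
have h1 := htest _ Tt tx; rewrite -/t -a2E in h1.
apply: le_trans (rho_test_lip _ That Theta_vartheta Tt) _; rewrite -/C2 -/v.
have h2 : n%:R * (a2 * (delta0 ^+ 2 / 4)) <= n%:R * (a2 * t ^+ 2).
  rewrite ler_pM2l// ler_pM2l//; apply: le_trans t2; rewrite ler_pM2r//.
  by apply: lerXn2r; rewrite ?nnegrE// ltW.
have h3 : n%:R * (C2 * v) <= n%:R * (a2 * (delta0 ^+ 2 / 4)).
  rewrite ler_pM2l//.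
  move: xC2; rewrite ler_pdivrMr ?mulr_gt0 ?exprn_gt0// => xC2.
  rewrite -(ler_pM2r x0) -mulrA.
  apply: (@le_trans _ _ (C2 * eta0)); first by rewrite ler_wpM2l// ltW.
  lra.
lra.
Qed.

End Model.

(** * Separation of the model in Hellinger distance *)

Section SquareIntegrable.
Context {dT : measure_display} {T : measurableType dT} {R : realType} {d : nat}.
Variable mu : {measure set T -> \bar R}.

Lemma integrableZ_EFin (a : R) (f : T -> R) : mu.-integrable setT (EFin \o f) ->
  mu.-integrable setT (EFin \o (fun x => a * f x)).
Proof. exact: integrableZl. Qed.

Lemma Rintegral_sum (I : Type) (s : seq I) (f : I -> T -> R) :
  (forall i, mu.-integrable setT (EFin \o f i)) ->
  mu.-integrable setT (EFin \o (fun x => \sum_(i <- s) f i x)) /\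
  \int[mu]_x (\sum_(i <- s) f i x) = \sum_(i <- s) \int[mu]_x f i x.
Proof.
move=> fint; have sint (r : seq I) : mu.-integrable setT (EFin \o (fun x => \sum_(i <- r) f i x)).
  rewrite (_ : _ \o _ = fun x => \sum_(i <- r) (f i x)%:E)%E.
    by apply: integrable_sum => //= i _; exact: fint.
  by apply/funext => x /=; rewrite sumEFin.
split=> //; elim: s => [|i s ih].
  by under eq_Rintegral do rewrite big_nil; rewrite big_nil Rintegral_cst// mul0r.
rewrite big_cons -ih -RintegralD//.
by apply: eq_Rintegral => x _; rewrite big_cons.
Qed.

(* [h = (h F) F^-1], and [|(h F)_i|] is bounded by means of
   [2 |a b| <= l a ^ 2 + b ^ 2 / l] with [l] of order [1 / |h|]. *)
Lemma fisher_coercive (g : T -> 'rV[R]_d) :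
  (forall i, (fun x => g x 0 i) \in Lfun mu 2%:E) -> fisher_information mu g \in unitmx ->
  exists2 kappa : R, 0 < kappa & forall h : 'rV[R]_d,
    mu.-integrable setT (EFin \o (fun x => dotv h (g x) ^+ 2)) /\
    kappa * `|h| ^+ 2 <= \int[mu]_x (dotv h (g x) ^+ 2).
Proof.
move=> gL2 Fu.
have gg k l : mu.-integrable setT (EFin \o (fun x => g x 0 k * g x 0 l)).
  exact/Lfun1_integrable/(Lfun2_mul_Lfun1 (gL2 k) (gL2 l)).
have hgg (a : R) k l : mu.-integrable setT (EFin \o (fun x => a * (g x 0 k * g x 0 l))).
  exact: integrableZ_EFin.
have ag h i : mu.-integrable setT (EFin \o (fun x => dotv h (g x) * g x 0 i)) /\
    \int[mu]_x (dotv h (g x) * g x 0 i) = \sum_k h 0 k * \int[mu]_x (g x 0 k * g x 0 i).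
  have [] := @Rintegral_sum _ (index_enum 'I_d) _ (fun k => hgg (h 0 k) k i).
  have -> : (fun x => \sum_(k <- index_enum 'I_d) h 0 k * (g x 0 k * g x 0 i)) =
      (fun x => dotv h (g x) * g x 0 i).
    by apply/funext => x; rewrite /dotv mulr_suml; apply: eq_bigr => k _; rewrite mulrA.
  by move=> H1 ->; split=> //; apply: eq_bigr => k _; rewrite RintegralZl.
have aa h : mu.-integrable setT (EFin \o (fun x => dotv h (g x) ^+ 2)).
  have hag l : mu.-integrable setT (EFin \o (fun x => h 0 l * (dotv h (g x) * g x 0 l))).
    by apply: integrableZ_EFin; have [] := ag h l.
  have [H _] := @Rintegral_sum _ (index_enum 'I_d) _ hag.
  rewrite (_ : (fun x => dotv h (g x) ^+ 2) =
    (fun x => \sum_(l <- index_enum 'I_d) h 0 l * (dotv h (g x) * g x 0 l)))//.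
  apply/funext => x; rewrite expr2 {1}/dotv mulr_suml; apply: eq_bigr => k _.
  by rewrite -mulrA (mulrC (g x 0 k)).
pose q h := \int[mu]_x (dotv h (g x) ^+ 2).
have q0 h : 0 <= q h by apply: Rintegral_ge0 => x _; exact: sqr_ge0.
pose N := \sum_(i < d) \int[mu]_x (g x 0 i * g x 0 i).
have N0 : 0 <= N.
  by apply: sumr_ge0 => i _; apply: Rintegral_ge0 => x _; rewrite -expr2 sqr_ge0.
set F := fisher_information mu g in Fu.
pose K := \sum_(i < d) \sum_(j < d) `|invmx F i j|.
have K0 : 0 <= K by apply: sumr_ge0 => i _; apply: sumr_ge0.
have KF i j : `|invmx F i j| <= K.
  rewrite /K (bigD1 i)//= (bigD1 j)//= -addrA lerDl addr_ge0//; first exact: sumr_ge0.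
  by apply: sumr_ge0 => k _; exact: sumr_ge0.
have hF h i : (h *m F) 0 i = 4 * \int[mu]_x (dotv h (g x) * g x 0 i).
  rewrite (ag h i).2 mxE mulr_sumr; apply: eq_bigr => k _.
  by rewrite !mxE mulrCA.
have hFle h i (l : R) : 0 < l ->
    `|(h *m F) 0 i| <= 2 * (l * q h + l^-1 * \int[mu]_x (g x 0 i * g x 0 i)).
  move=> l0; rewrite hF.
  have I1 : mu.-integrable setT (EFin \o (fun x => l * dotv h (g x) ^+ 2)) by exact: integrableZ_EFin.
  have I2 : mu.-integrable setT (EFin \o (fun x => l^-1 * (g x 0 i * g x 0 i))) by exact: integrableZ_EFin.
  have -> : 2 * (l * q h + l^-1 * \int[mu]_x (g x 0 i * g x 0 i)) =
      2 * \int[mu]_x (l * dotv h (g x) ^+ 2 + l^-1 * (g x 0 i * g x 0 i)).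
    by rewrite RintegralD// !RintegralZl.
  have -> : (4 : R) = 2 * 2 by ring.
  rewrite -mulrA normrM ger0_norm// ler_pM2l//.
  have I3 (e : R) : mu.-integrable setT (EFin \o (fun x => e * (dotv h (g x) * g x 0 i))).
    by apply: integrableZ_EFin; have [] := ag h i.
  have I4 : mu.-integrable setT
     (EFin \o (fun x => l * dotv h (g x) ^+ 2 + l^-1 * (g x 0 i * g x 0 i))).
    exact: (integrableD measurableT I1 I2).
  have am (a b : R) (e : R) : e ^+ 2 = 1 -> e * 2 * (a * b) <= l * a ^+ 2 + l^-1 * (b * b).
    move=> e2; have := mulr_ge0 (ltW l0) (sqr_ge0 (a - e * l^-1 * b)).
    have -> : l * (a - e * l^-1 * b) ^+ 2 =
      l * a ^+ 2 + e ^+ 2 * (l^-1 * (b * b)) - e * 2 * (a * b).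
      by field; rewrite gt_eqF.
    by rewrite e2 mul1r subr_ge0.
  rewrite ler_norml lerNl -mulNr; apply/andP; split.
    rewrite -RintegralZl//; last by have [] := ag h i.
    apply: le_Rintegral => // x _; have := @am (dotv h (g x)) (g x 0 i) (-1).
    by rewrite mulN1r; apply; rewrite sqrrN expr1n.
  rewrite -RintegralZl//; last by have [] := ag h i.
  apply: le_Rintegral => // x _; have := @am (dotv h (g x)) (g x 0 i) 1.
  by rewrite mul1r; apply; rewrite expr1n.
have hle h (l : R) : 0 < l -> `|h| <= 2 * K * (d%:R * (l * q h) + l^-1 * N).
  move=> l0.
  have S : \sum_(i < d) `|(h *m F) 0 i| <= 2 * (d%:R * (l * q h) + l^-1 * N).
    apply: (le_trans (ler_sum _ (fun i _ => hFle h i l l0))).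
    by rewrite -mulr_sumr big_split/= sumr_const card_ord -mulr_sumr -[_ *+ d]mulr_natl.
  apply: (@le_trans _ _ (K * \sum_(i < d) `|(h *m F) 0 i|)); last first.
    by rewrite (mulrC 2) -mulrA ler_wpM2l.
  apply: rV_norm_le => [|j]; first by rewrite mulr_ge0// sumr_ge0.
  rewrite -{1}[h](mulmxK Fu) mxE; apply: le_trans (ler_norm_sum _ _ _) _.
  rewrite mulr_sumr; apply: ler_sum => i _.
  by rewrite normrM mulrC ler_wpM2r.
(* With [l = l0 / |h|], the term in [N] is at most [|h| / 2] and is absorbed by the left-hand
   side. *)
pose l0 := 4 * K * N + 1.
have l00 : 0 < l0 by rewrite ltr_wpDl// !mulr_ge0.
pose Z := 4 * K * d%:R * l0 + 1.
have Z0 : 0 < Z by rewrite ltr_wpDl// !mulr_ge0// ltW.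
exists Z^-1; first by rewrite invr_gt0.
move=> h; split=> //; rewrite -/(q h) mulrC ler_pdivrMr//.
have [->|h0] := eqVneq h 0; first by rewrite normr0 expr0n/= mulr_ge0// ltW.
have r0 : 0 < `|h| by rewrite normr_gt0.
have := hle h (l0 / `|h|) (divr_gt0 l00 r0).
rewrite invf_div.
have hN : 2 * K * (`|h| / l0 * N) <= `|h| / 2.
  have -> : 2 * K * (`|h| / l0 * N) = `|h| * (2 * K * N) / l0 by field; rewrite gt_eqF.
  by rewrite ler_pdivrMr// -[leRHS]mulrA ler_pM2l// /l0; lra.
move=> hh; have {hh} : `|h| / 2 <= 2 * K * (d%:R * (l0 / `|h| * q h)) by lra.
have -> : 2 * K * (d%:R * (l0 / `|h| * q h)) = 2 * K * d%:R * l0 * q h / `|h|.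
  by field; rewrite gt_eqF.
rewrite ler_pdivlMr// => hh.
have := q0 h; rewrite /Z; lra.
Qed.

End SquareIntegrable.

(** * Local separation from the Fisher information *)

Section LocalSeparation.
Context {dT : measure_display} {T : measurableType dT} {R : realType} {d : nat}.
Variable mu : {measure set T -> \bar R}.

(** A crude constant: [sqrt d] would do, but [d + 1] is positive even for [d = 0]. *)
Lemma enorm_le (v : 'rV[R]_d) : enorm v <= d.+1%:R * `|v|.
Proof.
rewrite /enorm -[leRHS]ger0_norm ?mulr_ge0// -sqrtr_sqr ler_wsqrtr// /dotv.
apply: (@le_trans _ _ (\sum_(i < d) `|v| ^+ 2)).
  apply: ler_sum => i _; rewrite -expr2 -real_normK ?num_real//.
  by apply: lerXn2r; rewrite ?nnegrE//; exact: rV_coord_le_norm.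
rewrite sumr_const card_ord -[_ *+ d]mulr_natl exprMn ler_wpM2r ?sqr_ge0//.
by rewrite -natrX ler_nat (leq_trans (leqnSn d))// expnS expn1 leq_pmulr.
Qed.

Lemma norm_le_enorm (v : 'rV[R]_d) : `|v| <= enorm v.
Proof.
apply: rV_norm_le => [|i]; first exact: sqrtr_ge0.
rewrite /enorm -sqrtr_sqr ler_wsqrtr// /dotv (bigD1 i)//= expr2 lerDl.
by apply: sumr_ge0 => j _; rewrite -expr2 sqr_ge0.
Qed.

(** With [rem] the Taylor remainder, the square of the linear term is at most
    [2 (f (theta + h) - f theta)^2 + 2 rem^2]. Its integral is at least [kappa |h|^2] by coercivity,
    and for small [h] the remainder accounts for at most half of that. *)
Lemma l2_derivative_separation (f : 'rV[R]_d -> T -> R) (theta : 'rV[R]_d)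
    (g : T -> 'rV[R]_d) :
  is_L2_derivative mu f theta g -> fisher_information mu g \in unitmx ->
  exists c delta : R, [/\ 0 < c, 0 < delta & forall h : 'rV[R]_d, `|h| < delta ->
    measurable_fun setT (f (theta + h)) -> measurable_fun setT (f theta) ->
    ((c * `|h| ^+ 2)%:E <= \int[mu]_x ((f (theta + h) x - f theta x) ^+ 2)%:E)%E].
Proof.
move=> [gL2 gcvg] Fu.
have [kappa k0 Hk] := fisher_coercive gL2 Fu.
pose D1 : R := d.+1%:R.
have D10 : 0 < D1 by rewrite ltr0n.
(* The factor [D1] pays for the passage from the Euclidean norm to the sup norm. *)
have [e e0 eD] : exists2 e : R, 0 < e & (e * D1) ^+ 2 = kappa / 4.
  exists (Num.sqrt (kappa / 4) / D1); first by rewrite divr_gt0// sqrtr_gt0 divr_gt0.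
  by rewrite divfK ?gt_eqF// sqr_sqrtr// divr_ge0// ltW.
have nb : nbhs (0%E : \bar R) [set x | x < e%:E]%E.
  by apply: open_ereal_lt'; rewrite lte_fin.
have /nbhs_ballP[delta /= delta0 Hd] := gcvg _ nb.
exists (kappa / 4), delta; split => //; first by rewrite divr_gt0.
move=> h hd mfh mf.
have [->|h0] := eqVneq h 0.
  rewrite normr0 expr0n/= mulr0; apply: integral_ge0 => x _.
  by rewrite lee_fin sqr_ge0.
have /Hd : ball (0 : 'rV[R]_d) delta h by rewrite -ball_normE/= sub0r normrN.
move=> /(_ h0)/=.
pose rem x := f (theta + h) x - f theta x - dotv h (g x).
rewrite -/(rem _) => Hrem.
have r0 : 0 < enorm h by apply: lt_le_trans (norm_le_enorm h); rewrite normr_gt0.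
have mg i : measurable_fun setT (fun x => g x 0 i).
  by have := gL2 i; rewrite inE => /andP[]; rewrite inE.
have mdot : measurable_fun setT (fun x => dotv h (g x)).
  by apply: measurable_sum => i; exact: measurable_funM.
have mrem : measurable_fun setT rem.
  by apply: measurable_funB => //; exact: measurable_funB.
have remle : (\int[mu]_x (rem x ^+ 2)%:E <= (kappa / 4 * `|h| ^+ 2)%:E)%E.
  have -> : (\int[mu]_x (rem x ^+ 2)%:E = 'N[mu]_2%:E[EFin \o rem] `^ 2)%E.
    rewrite poweR_Lnorm//; apply: eq_integral => x _ /=.
    by rewrite powR_mulrn// real_normK ?num_real.
  move: Hrem; rewrite lte_pdivrMr// -EFinM => /ltW Hrem.
  have := gt0_ler_poweR (ler0n R 2) _ _ Hrem.
  move=> /(_ _ _)/le_trans; apply.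
  - by rewrite in_itv/= Lnorm_ge0 leey.
  - by rewrite in_itv/= leey lee_fin mulr_ge0// ltW.
  rewrite poweR_EFin powR_mulrn; last by rewrite mulr_ge0// ltW.
  rewrite lee_fin -eD -exprMn; apply: lerXn2r; rewrite ?nnegrE ?mulr_ge0 ?(ltW e0) ?(ltW r0) ?(ltW D10)//.
  by rewrite -mulrA ler_pM2l// enorm_le.
have mD : measurable_fun setT (fun x => f (theta + h) x - f theta x) by exact: measurable_funB.
have [hint hle] := Hk h.
have main : ((kappa * `|h| ^+ 2)%:E <=
    \int[mu]_x (2 * (f (theta + h) x - f theta x) ^+ 2)%:E +
    \int[mu]_x (2 * rem x ^+ 2)%:E)%E.
  apply: (@le_trans _ _ (\int[mu]_x (dotv h (g x) ^+ 2)%:E)%E).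
    by rewrite -[leRHS]fineK ?lee_fin//; exact: integrable_fin_num.
  rewrite -ge0_integralD//; last 4 first.
  - by move=> x _; rewrite lee_fin mulr_ge0// sqr_ge0.
  - by apply/measurable_EFinP; apply: measurable_funM => //; exact: measurable_funX.
  - by move=> x _; rewrite lee_fin mulr_ge0// sqr_ge0.
  - by apply/measurable_EFinP; apply: measurable_funM => //; exact: measurable_funX.
  apply: ge0_le_integral => //.
  - by move=> x _; rewrite lee_fin sqr_ge0.
  - by apply/measurable_EFinP; exact: measurable_funX.
  - apply/measurable_EFinP; apply: measurable_funD; apply: measurable_funM => //; exact: measurable_funX.
  move=> x _; rewrite -EFinD lee_fin /rem.
  set a := f _ x - _; set b := dotv _ _.
  by have := sqr_ge0 (2 * a - b); lra.
have Z k (u : T -> R) : 0 <= k -> measurable_fun setT u ->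
    (\int[mu]_x (k * u x ^+ 2)%:E = k%:E * \int[mu]_x (u x ^+ 2)%:E)%E.
  move=> k00 mu'; under eq_integral do rewrite EFinM.
  rewrite ge0_integralZl//.
  - by apply/measurable_EFinP; exact: measurable_funX.
  - by move=> x _; rewrite lee_fin sqr_ge0.
move: main remle; rewrite !Z//.
(* The integrals are still extended reals: an infinite increment makes the bound trivial, and
   [remle] excludes an infinite remainder. *)
have : (0%E <= \int[mu]_x ((f (theta + h) x - f theta x) ^+ 2)%:E)%E.
  by apply: integral_ge0 => x _; rewrite lee_fin sqr_ge0.
case: (integral _ _ _) => [a _|_ _ _|//]; last exact: leey.
have : (0%E <= \int[mu]_x (rem x ^+ 2)%:E)%E.
  by apply: integral_ge0 => x _; rewrite lee_fin sqr_ge0.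
case: (integral _ _ _) => [b _|_ _|//]; last by rewrite leye_eq.
rewrite -!EFinM -EFinD !lee_fin; lra.
Qed.

End LocalSeparation.

Lemma psi_score (R : realType) (a b : R) : 0 < a -> 0 < b -> (Num.sqrt 2)^-1 * psi ((b / a)%:E) = score a b.
Proof.
move=> a0 b0; rewrite /psi /score.
have s2 : 0 < Num.sqrt 2 :> R by rewrite sqrtr_gt0.
have s22 : Num.sqrt 2 ^+ 2 = 2 :> R by rewrite sqr_sqrtr.
have -> : qmean a b = a * Num.sqrt (1 + (b / a) ^+ 2) / Num.sqrt 2.
  rewrite /qmean -{2}[a](ger0_norm (ltW a0)) -sqrtr_sqr -sqrtrM ?sqr_ge0//.
  have p0 : 0 <= a ^+ 2 * (1 + (b / a) ^+ 2).
    by apply: mulr_ge0; rewrite ?sqr_ge0// addr_ge0// sqr_ge0.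
  rewrite -sqrtrV// -sqrtrM//.
  by congr Num.sqrt; field; rewrite gt_eqF.
have r0 : 0 < Num.sqrt (1 + (b / a) ^+ 2) by rewrite sqrtr_gt0 ltr_wpDr// sqr_ge0.
move: r0; set r := Num.sqrt (1 + _) => r0.
transitivity ((b - a) * Num.sqrt 2 / (Num.sqrt 2 ^+ 2 * (a * r))).
  by field; rewrite !gt_eqF.
by rewrite s22; field; rewrite !gt_eqF.
Qed.

Section CompactLipschitz.
Context {R : realType} {V : normedModType R}.

Lemma closed_far (x0 : V) (tau : R) : closed [set x | tau <= `|x - x0|].
Proof.
have /continuous_closedP : continuous (fun x : V => `|x - x0|).
  by move=> x; apply: cvg_norm; apply: cvgB; [exact: cvg_id|exact: cvg_cst].
by move=> /(_ [set r | tau <= r]); apply; exact: closed_ge.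
Qed.

Lemma lipschitz_min (K : set V) (f : V -> R) (L : R) : K !=set0 -> compact K ->
  (forall x y, K x -> K y -> `|f x - f y| <= L * `|x - y|) ->
  exists2 x, K x & forall y, K y -> f x <= f y.
Proof.
move=> K0 cK fL.
have cf : {within K, continuous f}.
  apply/subspace_continuousP => x Kx; apply/cvgrPdist_le => e e0.
  have d0 : 0 < e / (`|L| + 1) by rewrite divr_gt0// ltr_wpDl.
  rewrite near_withinE; near=> y => Ky; apply: le_trans (fL _ _ Kx Ky) _.
  have h : `|x - y| <= e / (`|L| + 1).
    by near: y; apply: cvgr_dist_le => //; exact: cvg_id.
  apply: (@le_trans _ _ ((`|L| + 1) * `|x - y|)).
    by rewrite ler_wpM2r//; have := ler_norm L; lra.
  by rewrite mulrC -ler_pdivlMr// ltr_wpDl.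
have [x] := compact_EVT_min K0 cK cf; rewrite inE => Kx xmin.
by exists x => // y Ky; apply: xmin; rewrite inE.
Unshelve. all: by end_near. Qed.

End CompactLipschitz.

(** * Density ratios of the parametric family and global Hellinger separation *)

Section ParametricFamily.
Context {dT : measure_display} {T : measurableType dT} {R : realType} {d : nat}.
Local Notation V := 'rV[R]_d.
Variables (mu : {measure set T -> \bar R}) (t : V -> T -> R) (Theta : set V) (vartheta : V).
Hypothesis t_density : forall theta, Theta theta -> is_density mu (t theta).
Hypothesis Theta_vartheta : Theta vartheta.
Variable Q : probability T R.
Hypothesis Q_law : forall A, measurable A ->
  Q A = (\int[mu]_(x in A) (t vartheta x)%:E)%E.
Variables (A1 M : R).
Hypothesis ratio_lipschitz : forall theta eta theta',
  Theta theta -> Theta eta -> Theta theta' ->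
  (ereal_sup (range (fun x =>
     `| sqrt_ratio (t theta) (t theta') x - sqrt_ratio (t eta) (t theta') x |))
   <= (A1 * enorm (eta - theta))%:E)%E.
Hypotheses (M0 : 0 < M) (Theta_M : forall theta, Theta theta -> `|theta| <= M).

Let mt theta : Theta theta -> measurable_fun setT (t theta).
Proof. by case/t_density. Qed.

Let t_ge0 theta x : Theta theta -> 0 <= t theta x.
Proof. by case/t_density. Qed.

Let ratio_lip theta eta theta' x : Theta theta -> Theta eta -> Theta theta' ->
  (`| sqrt_ratio (t theta) (t theta') x - sqrt_ratio (t eta) (t theta') x |
   <= (A1 * enorm (eta - theta))%:E)%E.
Proof.
move=> Tt Te Tt'; apply: le_trans (ratio_lipschitz Tt Te Tt').
by apply: ereal_sup_ubound; exists x.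
Qed.

Lemma sqrt_ratio_self (u : T -> R) x : 0 <= u x -> sqrt_ratio u u x = 1%E.
Proof.
move=> u0; rewrite /sqrt_ratio /ratioe.
by case: eqVneq => [_|u1] /=; rewrite ?divff// sqrtr1.
Qed.

(* Otherwise the distance to [1] of a ratio equal to [+oo] would be finite. *)
Lemma common_zeros theta eta x : Theta theta -> Theta eta -> t theta x = 0 -> t eta x = 0.
Proof.
move=> Tt Te t0; apply/eqP; apply/negPn/negP => e0.
have := ratio_lip x Te Tt Tt; rewrite (sqrt_ratio_self (t_ge0 x Tt)).
by rewrite /sqrt_ratio /ratioe t0 eqxx (negbTE e0)/=.
Qed.

(* All the densities of the model vanish where [t vartheta] does; the value [1] there
   agrees with the convention [0 / 0 = 1]. *)
Definition root_ratio theta x : R :=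
  if t vartheta x == 0 then 1 else Num.sqrt (t theta x / t vartheta x).
Local Notation W := root_ratio.

(** The absolute value ensures nonnegativity, and [d + 1] converts the Euclidean norm of the
    hypothesis into the sup norm. *)
Definition lip_const := `|A1| * d.+1%:R.
Local Notation A := lip_const.
Definition bound_const := 1 + A * (2 * M).
Local Notation B := bound_const.

Lemma lip_const_ge0 : 0 <= A. Proof. exact: mulr_ge0. Qed.

Lemma bound_const_ge1 : 1 <= B.
Proof. by rewrite lerDl !mulr_ge0 ?lip_const_ge0// ltW. Qed.

Let A1_enorm (v : V) : A1 * enorm v <= A * `|v|.
Proof.
apply: (@le_trans _ _ (`|A1| * enorm v)); first by rewrite ler_wpM2r ?ler_norm// sqrtr_ge0.
by rewrite /lip_const -mulrA ler_wpM2l// enorm_le.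
Qed.

Lemma sqrt_ratioE theta eta x : Theta theta -> Theta eta ->
  sqrt_ratio (t theta) (t eta) x = (W theta x / W eta x)%:E.
Proof.
move=> Tt Te; rewrite /sqrt_ratio /ratioe /root_ratio.
have [s0|s0] := eqVneq (t vartheta x) 0.
  by rewrite (common_zeros Theta_vartheta Tt s0) (common_zeros Theta_vartheta Te s0) eqxx/= sqrtr1 divr1.
have [e0|e0] := eqVneq (t eta x) 0.
  by rewrite (common_zeros Te Theta_vartheta e0) eqxx in s0.
rewrite /=; congr EFin; rewrite -sqrtrV ?divr_ge0 ?t_ge0// -sqrtrM ?divr_ge0 ?t_ge0//.
by congr Num.sqrt; field; rewrite e0 s0.
Qed.

Lemma root_ratio_true x : W vartheta x = 1.
Proof. by rewrite /root_ratio; case: eqVneq => // s0; rewrite divff// sqrtr1. Qed.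

Lemma root_ratio_lip theta eta x : Theta theta -> Theta eta ->
  `|W theta x - W eta x| <= A * `|theta - eta|.
Proof.
move=> Tt Te; have := ratio_lip x Tt Te Theta_vartheta.
rewrite !sqrt_ratioE// root_ratio_true !divr1 -EFinB abse_EFin lee_fin => h.
by apply: le_trans h _; rewrite distrC; exact: A1_enorm.
Qed.

Lemma root_ratio_gt0 theta x : Theta theta -> 0 < W theta x.
Proof.
move=> Tt; rewrite /root_ratio; case: eqVneq => // s0.
have t0 : t theta x != 0.
  by apply: contra_neq s0; exact: common_zeros.
by rewrite sqrtr_gt0 divr_gt0// lt0r ?t0 ?s0 t_ge0.
Qed.

(** Two parameters are at distance at most [2 M]. Upper bound: [W theta] is that close, up to the
    factor [A], to [W vartheta = 1]. Lower bound: the hypothesis on ratios, with [t theta] as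
    denominator, says the same of [1 / W theta]. *)
Lemma root_ratio_bound theta x : Theta theta -> B^-1 <= W theta x <= B.
Proof.
move=> Tt; have B1 := bound_const_ge1.
have w0 := root_ratio_gt0 x Tt.
have dist : A * `|theta - vartheta| <= A * (2 * M).
  rewrite ler_wpM2l ?lip_const_ge0//; apply: le_trans (ler_normB _ _) _.
  by rewrite mulr_natl mulr2n lerD// Theta_M.
apply/andP; split; last first.
  have := root_ratio_lip x Tt Theta_vartheta; rewrite root_ratio_true => h.
  by rewrite /bound_const; have := ler_norm (W theta x - 1); lra.
have := ratio_lip x Theta_vartheta Tt Tt; rewrite !sqrt_ratioE// root_ratio_true.
rewrite divff ?gt_eqF// div1r -EFinB abse_EFin lee_fin => h.
rewrite invf_ple ?posrE//; last lra.
have := A1_enorm (theta - vartheta); have := ler_norm ((W theta x)^-1 - 1).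
by rewrite /bound_const; lra.
Qed.

Lemma measurable_root_ratio theta : Theta theta -> measurable_fun setT (W theta).
Proof.
move=> Tt; rewrite /root_ratio; apply: measurable_fun_ifT.
- by apply: measurable_fun_eqr => //; exact: mt.
- exact: measurable_cst.
apply: measurable_sqrt; apply: measurable_funM; first exact: mt.
rewrite (_ : (fun x => _) = (fun x => t vartheta x `^ -1)); last first.
  by apply/funext => x; rewrite powR_inv1// t_ge0.
exact: (measurableT_comp (measurable_powR _) (mt Theta_vartheta)).
Qed.

Lemma sqrt_density theta x : Theta theta ->
  Num.sqrt (t theta x) = Num.sqrt (t vartheta x) * W theta x.
Proof.
move=> Tt; rewrite /root_ratio; case: eqVneq => [s0|s0].
  by rewrite s0 (common_zeros Theta_vartheta Tt s0) sqrtr0 mul0r.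
by rewrite -sqrtrM ?t_ge0// mulrC divfK.
Qed.

Lemma density_transport (g : T -> R) : measurable_fun setT g -> (forall x, 0 <= g x) ->
  (\int[mu]_x (t vartheta x * g x)%:E = \int[Q]_x (g x)%:E)%E.
Proof.
move=> mg g0; rewrite -[RHS]mul1e.
apply: (@ge0_integral_transport _ _ _ _ _ mu Q (t vartheta) id 1) => //.
- exact: mt.
- by move=> x; exact: t_ge0.
move=> D mD; rewrite mul1e; transitivity (\int[mu]_(x in D) (t vartheta x)%:E)%E; last first.
  by apply/esym; exact: Q_law.
rewrite [RHS]integral_mkcond; apply: eq_integral => x _; rewrite patchE indicE.
by case: ifP => _; rewrite ?mulr1 ?mulr0.
Qed.

Lemma density_transport_fine (g h : T -> R) : measurable_fun setT g -> (forall x, 0 <= g x) ->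
  (forall x, h x = t vartheta x * g x) -> \int[mu]_x h x = \int[Q]_x g x.
Proof.
move=> mg g0 hg; rewrite /Rintegral -density_transport//; congr fine.
by apply: eq_integral => x _; rewrite hg.
Qed.

Let sB (f : T -> R) : measurable_fun setT f -> measurable_fun setT (fun x => f x ^+ 2).
Proof. exact: measurable_funX. Qed.

Lemma root_ratio_mean_square theta : Theta theta -> \int[Q]_x (W theta x ^+ 2) = 1.
Proof.
move=> Tt; rewrite -(@density_transport_fine _ (t theta)).
- by rewrite /Rintegral; have [_ _ ->] := t_density Tt.
- exact/sB/measurable_root_ratio.
- by move=> x; exact: sqr_ge0.
move=> x; rewrite -[LHS]sqr_sqrtr ?t_ge0// sqrt_density// exprMn sqr_sqrtr//.
exact: t_ge0.
Qed.

Definition sqdist theta eta := \int[Q]_x ((W theta x - W eta x) ^+ 2).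

Lemma sqr_sqrt_density theta eta x : Theta theta -> Theta eta ->
  (Num.sqrt (t theta x) - Num.sqrt (t eta x)) ^+ 2 =
  t vartheta x * (W theta x - W eta x) ^+ 2.
Proof.
move=> Tt Te; rewrite (sqrt_density x Tt) (sqrt_density x Te) -mulrBr exprMn sqr_sqrtr//; exact: t_ge0.
Qed.

Let msq theta eta : Theta theta -> Theta eta ->
  measurable_fun setT (fun x => (W theta x - W eta x) ^+ 2).
Proof. by move=> Tt Te; apply: sB; apply: measurable_funB; exact: measurable_root_ratio. Qed.

Lemma hellingerE theta eta : Theta theta -> Theta eta ->
  hellinger mu (t theta) (t eta) = Num.sqrt (2^-1 * sqdist theta eta).
Proof.
move=> Tt Te; rewrite /hellinger; congr (Num.sqrt (_ * _)).
apply: density_transport_fine => [|x|x]; [exact: msq|exact: sqr_ge0|].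
exact: sqr_sqrt_density.
Qed.

Let W_norm theta x : Theta theta -> `|W theta x| <= B.
Proof.
move=> Tt; rewrite gtr0_norm ?root_ratio_gt0//.
by have /andP[] := root_ratio_bound x Tt.
Qed.

Lemma mean_driftE theta eta : Theta theta -> Theta eta ->
  let r := fun x => (t theta x + t eta x) / 2 in
  affinity mu (t eta) r - affinity mu (t theta) r = mean_drift Q W theta eta.
Proof.
move=> Tt Te r.
have mq := measurable_qmean (measurable_root_ratio Tt) (measurable_root_ratio Te).
have aff zeta : Theta zeta -> affinity mu (t zeta) r =
    \int[Q]_x (W zeta x * qmean (W theta x) (W eta x)).
  move=> Tz; apply: density_transport_fine.
  - by apply: measurable_funM => //; exact: measurable_root_ratio.
  - by move=> x; rewrite mulr_ge0 ?qmean_ge0// ltW// root_ratio_gt0.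
  move=> x; rewrite sqrtrM ?t_ge0// sqrt_density//.
  have -> : r x = t vartheta x * ((W theta x ^+ 2 + W eta x ^+ 2) / 2).
    rewrite /r -[t theta x]sqr_sqrtr ?t_ge0// -[t eta x]sqr_sqrtr ?t_ge0//.
    by rewrite (sqrt_density x Tt) (sqrt_density x Te) !exprMn sqr_sqrtr ?t_ge0//; field.
  rewrite sqrtrM ?t_ge0// -/(qmean _ _) mulrACA -expr2 sqr_sqrtr//.
  exact: t_ge0.
have qB x : `|qmean (W theta x) (W eta x)| <= B.
  rewrite ger0_norm ?qmean_ge0//; apply: qmean_le_max; apply/andP; split.
  - exact/ltW/root_ratio_gt0.
  - by have /andP[] := root_ratio_bound x Tt.
  - exact/ltW/root_ratio_gt0.
  - by have /andP[] := root_ratio_bound x Te.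
rewrite !aff// -(@expectationB _ _ _ _ _ _ (B * B) (B * B)); last 4 first.
- by apply: measurable_funM => //; exact: measurable_root_ratio.
- by apply: measurable_funM => //; exact: measurable_root_ratio.
- by move=> x; rewrite normrM ler_pM// W_norm.
- by move=> x; rewrite normrM ler_pM// W_norm.
by apply: eq_Rintegral => x _; rewrite -mulrBl.
Qed.

Lemma rho_T_eq theta eta n (x : 'I_n -> T) : Theta theta -> Theta eta ->
  rho_T mu x (t theta) (t eta) = rho_test Q W theta eta x.
Proof.
move=> Tt Te; rewrite /rho_T mean_driftE// /rho_test mulr_sumr; congr (_ + _).
by apply: eq_bigr => i _; rewrite sqrt_ratioE// psi_score// root_ratio_gt0.
Qed.

Lemma sqdistC theta eta : sqdist theta eta = sqdist eta theta.
Proof. by apply: eq_Rintegral => x _; rewrite -[LHS]sqrrN opprB. Qed.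

Let diff_norm theta eta x : Theta theta -> Theta eta -> `|W theta x - W eta x| <= 2 * B.
Proof.
move=> Tt Te; apply: le_trans (ler_normB _ _) _.
by rewrite mulr_natl mulr2n lerD// W_norm.
Qed.

Let bsq theta eta x : Theta theta -> Theta eta ->
  `|(W theta x - W eta x) ^+ 2| <= (2 * B) ^+ 2.
Proof.
move=> Tt Te; rewrite normrX; apply: lerXn2r; rewrite ?nnegrE//.
- by apply: le_trans (diff_norm x Tt Te).
- exact: diff_norm.
Qed.

Lemma EFin_sqdist theta eta : Theta theta -> Theta eta ->
  (\int[mu]_x ((Num.sqrt (t theta x) - Num.sqrt (t eta x)) ^+ 2)%:E =
   (sqdist theta eta)%:E)%E.
Proof.
move=> Tt Te; rewrite /sqdist -(@EFin_expectation _ _ _ Q _ ((2 * B) ^+ 2)).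
- rewrite -density_transport; [|exact: msq|by move=> x; exact: sqr_ge0].
  by apply: eq_integral => x _; rewrite sqr_sqrt_density.
- exact: msq.
- by move=> x; exact: bsq.
Qed.

Hypothesis t_inj : forall theta eta, Theta theta -> Theta eta ->
  (forall A : set T, measurable A ->
    (\int[mu]_(x in A) (t theta x)%:E = \int[mu]_(x in A) (t eta x)%:E)%E) ->
  theta = eta.

(** The square roots agree [mu]-almost everywhere, so the two densities define the same measure. *)
Lemma sqdist_eq0 theta eta : Theta theta -> Theta eta -> sqdist theta eta = 0 -> theta = eta.
Proof.
move=> Tt Te d0; apply: t_inj => // D mD.
have msd : measurable_fun setT
    (fun x => ((Num.sqrt (t theta x) - Num.sqrt (t eta x)) ^+ 2)%:E).
  by apply/measurable_EFinP/sB/measurable_funB; apply: measurable_sqrt; exact: mt.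
have ae0 : ae_eq mu setT
    (fun x => ((Num.sqrt (t theta x) - Num.sqrt (t eta x)) ^+ 2)%:E) (cst 0%E).
  apply/ae_eq_integral_abs => //.
  transitivity (\int[mu]_x ((Num.sqrt (t theta x) - Num.sqrt (t eta x)) ^+ 2)%:E)%E.
    by apply: eq_integral => x _; rewrite gee0_abs// lee_fin sqr_ge0.
  by rewrite EFin_sqdist// d0.
apply: ge0_ae_eq_integral => //.
- by apply/measurable_funTS/measurable_EFinP; exact: mt.
- by apply/measurable_funTS/measurable_EFinP; exact: mt.
- by move=> x _; rewrite lee_fin t_ge0.
- by move=> x _; rewrite lee_fin t_ge0.
apply: filterS ae0 => x /(_ I) [] /eqP.
rewrite sqrf_eq0 subr_eq0 => /eqP h _.
by rewrite -[t theta x]sqr_sqrtr ?t_ge0// h sqr_sqrtr ?t_ge0.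
Qed.

Lemma sqdist_lip theta theta' eta : Theta theta -> Theta theta' -> Theta eta ->
  `|sqdist theta eta - sqdist theta' eta| <= 4 * B * A * `|theta - theta'|.
Proof.
move=> Tt Tt' Te; rewrite -(@expectationB _ _ _ _ _ _ ((2 * B) ^+ 2) ((2 * B) ^+ 2)); last 4 first.
- exact: msq.
- exact: msq.
- by move=> x; exact: bsq.
- by move=> x; exact: bsq.
apply: expectation_norm_le => [|x]; first by apply: measurable_funB; exact: msq.
rewrite subr_sqr normrM.
have -> : W theta x - W eta x - (W theta' x - W eta x) = W theta x - W theta' x by ring.
rewrite mulrC -[leRHS]mulrA; apply: ler_pM => //; last exact: root_ratio_lip.
apply: le_trans (ler_normD _ _) _.
by have := diff_norm x Tt Te; have := diff_norm x Tt' Te; lra.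
Qed.

Hypothesis Theta_compact : compact Theta.

(** A Lipschitz function attains its minimum on the compact set of far parameters, and
    identifiability makes it positive. Besides the global separation from [vartheta], this gives a
    converse around the MLE: Hellinger proximity implies proximity of parameters. *)
Lemma sqdist_far theta0 tau : Theta theta0 -> 0 < tau ->
  exists2 eps : R, 0 < eps & forall eta, Theta eta -> tau <= `|eta - theta0| ->
    eps <= sqdist eta theta0.
Proof.
move=> T0 tau0.
pose K := Theta `&` [set eta | tau <= `|eta - theta0|].
have cK : compact K by apply: compact_closedI => //; exact: closed_far.
have [K0|/set0P K0] := eqVneq K set0.
  exists 1 => // eta Te h; have : K eta by [].
  by rewrite K0.
have [|zeta [Tz hz] zmin] := @lipschitz_min _ _ K (fun eta => sqdist eta theta0) (4 * B * A) K0 cK.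
  by move=> eta eta' [Te _] [Te' _]; exact: sqdist_lip.
exists (sqdist zeta theta0); last by move=> eta Te h; exact: zmin.
rewrite lt_neqAle eq_sym; apply/andP; split.
  apply: contraTneq hz => /(sqdist_eq0 Tz T0) ->.
  by rewrite subrr normr0 -ltNge.
by apply: Rintegral_ge0 => x _; exact: sqr_ge0.
Qed.

Lemma sqdist_separation (g : T -> V) :
  is_L2_derivative mu (fun eta x => Num.sqrt (t eta x)) vartheta g ->
  fisher_information mu g \in unitmx ->
  exists2 c : R, 0 < c & forall theta, Theta theta ->
    c * `|theta - vartheta| ^+ 2 <= \int[Q]_x ((W theta x - 1) ^+ 2).
Proof.
move=> dg Fu.
have [c1 [delta [c10 delta0 near_sep]]] := l2_derivative_separation dg Fu.
have [eps eps0 far_sep] := sqdist_far Theta_vartheta delta0.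
(* [2 * M] bounds the distance to [vartheta], so a constant lower bound [eps] is also a quadratic
   one. *)
exists (Num.min c1 (eps / (2 * M) ^+ 2)).
  by rewrite lt_min c10 divr_gt0// exprn_gt0// mulr_gt0.
move=> theta Tt.
have -> : \int[Q]_x ((W theta x - 1) ^+ 2) = sqdist theta vartheta.
  by apply: eq_Rintegral => x _; rewrite root_ratio_true.
have n0 : 0 <= `|theta - vartheta| ^+ 2 by exact: sqr_ge0.
have [h|h] := leP delta `|theta - vartheta|.
  apply: le_trans (far_sep _ Tt h).
  apply: (@le_trans _ _ (eps / (2 * M) ^+ 2 * `|theta - vartheta| ^+ 2)).
    by rewrite ler_wpM2r// ge_min lexx orbT.
  rewrite mulrAC ler_pdivrMr ?exprn_gt0 ?mulr_gt0// ler_pM2l//.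
  apply: lerXn2r; rewrite ?nnegrE// ?mulr_ge0 ?(ltW M0)//.
  by apply: le_trans (ler_normB _ _) _; rewrite mulr_natl mulr2n lerD// Theta_M.
apply: (@le_trans _ _ (c1 * `|theta - vartheta| ^+ 2)).
  by rewrite ler_wpM2r// ge_min lexx.
have := near_sep _ h; rewrite subrKC EFin_sqdist// lee_fin; apply.
- by apply: measurable_sqrt; exact: mt.
- by apply: measurable_sqrt; exact: mt.
Qed.

End ParametricFamily.

(** * From the abstract model to the likelihood and the countable set [S] *)

Theorem theorem19 (R : realType)
  (dT : measure_display) (T : measurableType dT)
  (mu : {measure set T -> \bar R})
  (d : nat) (Theta' : set 'rV[R]_d) (t : 'rV[R]_d -> T -> R)
  (Theta'_open : open Theta')
  (t_density : forall theta, Theta' theta -> is_density mu (t theta))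
  (t_inj : forall theta eta, Theta' theta -> Theta' eta ->
     (forall A : set T, measurable A ->
        (\int[mu]_(x in A) (t theta x)%:E = \int[mu]_(x in A) (t eta x)%:E)%E) ->
     theta = eta)
  (Theta : set 'rV[R]_d) (Theta_sub : Theta `<=` Theta')
  (dO : measure_display) (Omega : measurableType dO) (P : probability Omega R)
  (X : nat -> {RV P >-> T}) (s : T -> R)
  (X_iid : iid_with_density mu s X)
  (* (i) *)
  (Theta_compact : compact Theta)
  (Theta_convex : convex_set Theta)
  (vartheta : 'rV[R]_d)
  (vartheta_interior : interior Theta vartheta)
  (s_true : s = t vartheta)
  (* (ii) *)
  (gdot : 'rV[R]_d -> T -> 'rV[R]_d)
  (t_regular : regular mu Theta' t gdot)
  (fisher_inv : forall theta, Theta theta ->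
     fisher_information mu (gdot theta) \in unitmx)
  (* (iii) *)
  (A1 : R)
  (ratio_lipschitz : forall theta eta theta',
     Theta theta -> Theta eta -> Theta theta' ->
     (ereal_sup (range (fun x =>
        `| sqrt_ratio (t theta) (t theta') x
           - sqrt_ratio (t eta) (t theta') x |))
      <= (A1 * enorm (eta - theta))%:E)%E)
  (* (iv) *)
  (mle : forall n : nat, ('I_n -> T) -> 'rV[R]_d)
  (mle_exists : with_probability_tending_to_1 P (fun n =>
     [set w | is_MLE Theta t (sample X n w) (mle n (sample X n w))]))
  (mle_consistent : forall eps : R, 0 < eps ->
     with_probability_tending_to_1 P (fun n =>
       [set w | enorm (mle n (sample X n w) - vartheta) < eps]))
  (S : set (T -> R))
  (S_dense : countable_dense_subset mu S (t @` Theta)) :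
  with_probability_tending_to_1 P (fun n =>
    [set w | hclosure mu (rho_E mu (sample X n w) S)
               (t (mle n (sample X n w)))]).
Proof.
have Theta_vartheta : Theta vartheta by exact: interior_subset.
have t_density' theta : Theta theta -> is_density mu (t theta).
  by move=> /Theta_sub; exact: t_density.
pose Q : probability T R := distribution P (X 0%N).
have Q_law A : measurable A -> Q A = (\int[mu]_(x in A) (t vartheta x)%:E)%E.
  by move=> mA; rewrite -s_true; case: X_iid => _ /(_ 0%N A mA).
have X_law i A : measurable A -> P (X i @^-1` A) = Q A.
  by move=> mA; rewrite Q_law// -s_true; case: X_iid => _ /(_ i A mA).
have X_indep : mutually_independent X by case: X_iid.
have [M M0 Theta_M] : exists2 M : R, 0 < M & forall theta, Theta theta -> `|theta| <= M.
  have [M0 [_ HM]] := compact_bounded Theta_compact.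
  exists (`|M0| + 1); first by rewrite ltr_wpDl.
  by move=> theta Tt; apply: (HM _ _ theta) => //; have := ler_norm M0; lra.
have t_inj' theta eta : Theta theta -> Theta eta ->
    (forall A, measurable A ->
       (\int[mu]_(x in A) (t theta x)%:E = \int[mu]_(x in A) (t eta x)%:E)%E) ->
    theta = eta.
  by move=> /Theta_sub Tt /Theta_sub Te; exact: t_inj.
have [_ t_diff _] := t_regular.
pose W := root_ratio t vartheta.
have far_sep := sqdist_far t_density' Theta_vartheta Q_law ratio_lipschitz M0 Theta_M t_inj' Theta_compact.
have [c c0 W_sep] := sqdist_separation t_density' Theta_vartheta Q_law ratio_lipschitz M0
  Theta_M t_inj' Theta_compact (t_diff _ (Theta_sub _ Theta_vartheta))
  (fisher_inv _ Theta_vartheta).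
have A0 := @lip_const_ge0 R d A1.
have B1 := @bound_const_ge1 R d A1 M M0.
have mW := measurable_root_ratio t_density' Theta_vartheta.
have WB := root_ratio_bound t_density' Theta_vartheta ratio_lipschitz M0 Theta_M.
have W_lip := root_ratio_lip t_density' Theta_vartheta ratio_lipschitz.
have W1 := root_ratio_true t vartheta.
have W0 := root_ratio_gt0 t_density' Theta_vartheta ratio_lipschitz.
have EW2 := root_ratio_mean_square t_density' Theta_vartheta Q_law ratio_lipschitz.
have main := mle_rho_test_whp X_indep X_law M0 Theta_M Theta_vartheta A0 B1 c0 mW WB W_lip W1 EW2 W_sep.
have t0 theta x : Theta theta -> 0 <= t theta x by case/t_density'.
(* If some [t vartheta (X i w)] were 0, all likelihoods would vanish and maximality would say
   nothing about the sums of [ln W]. This has probability 0 for every [n]. *)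
have pos_whp : with_probability_tending_to_1 P (fun n =>
    [set w | forall i : 'I_n, 0 < t vartheta (X i w)]).
  pose Z := [set x | t vartheta x == 0].
  have mZ : measurable Z.
    rewrite /Z -[X in measurable X]setTI.
    have [mt _ _] := t_density' _ Theta_vartheta.
    have H := @measurable_fun_eqr _ _ _ setT (t vartheta) (cst (0 : R)) mt (measurable_cst (0 : R)).
    by apply: (H measurableT [set true]).
  have mXZ i : measurable (X i @^-1` Z).
    by rewrite -[X in measurable X]setTI; exact: measurable_funP.
  have QZ : Q Z = 0%E.
    rewrite Q_law// integral0_eq// => x; rewrite /Z/= => /eqP ->//.
  apply: (@wpt1_of_bound _ _ _ _ _ (fun n => ~` \big[setU/set0]_(i < n) (X i @^-1` Z))).
    by move=> n; apply: measurableC; exact: bigsetU_measurable.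
  move=> e e0; exists 0%N => n _; split.
    move=> w Ew i; rewrite lt0r t0// andbT; apply/negP => Zi; apply: Ew.
    by rewrite (bigD1 i)//=; left.
  rewrite setCK; apply: le_trans (measure_bigsetU_le _ _ _) _ => //.
  rewrite big1 ?lee_fin ?ltW// => i _.
  exact: etrans (X_law i Z mZ) QZ.
have whp2 := @wpt1_impl2 _ _ _ P _ _ _ 0%N (fun n _ => @subset_refl _ _) main pos_whp.
apply: (@wpt1_impl2 _ _ _ P _ _ _ 0%N _ whp2 mle_exists).
move=> n _ w [[/= hmain hpos] [That hmle]].
set x := sample X n w in That hmle *.
set hat := mle n x in That hmle *.
(* [W] is the root of a density ratio, whence the square. The common factor, positive on the event
   above, cancels when likelihoods are compared. *)
have lik theta : Theta theta -> \prod_(i < n) t theta (x i) =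
    (\prod_(i < n) t vartheta (x i)) * expR (\sum_(i < n) ln (W theta (x i))) ^+ 2.
  move=> Tt; rewrite expR_sum -prodrXl -big_split/=; apply: eq_bigr => i _.
  rewrite lnK ?posrE ?W0// -[LHS]sqr_sqrtr ?t0//.
  rewrite (sqrt_density t_density' Theta_vartheta ratio_lipschitz _ Tt) exprMn sqr_sqrtr//.
  exact: t0.
have loglik theta : Theta theta ->
    \sum_(i < n) ln (W theta (X i w)) <= \sum_(i < n) ln (W hat (X i w)).
  move=> Tt; have := hmle _ Tt; rewrite (lik _ Tt) (lik _ That) ler_pM2l; last first.
    by apply: prodr_gt0 => i _; exact: hpos.
  by rewrite ler_pXn2r ?nnegrE ?expR_ge0// ler_expR.
have Tle8 := hmain _ That loglik.
have [S_sub S_close] : S `<=` t @` Theta /\ hclosure mu S (t hat).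
  by case: S_dense => _ S_sub S_dense'; split => //; apply: S_dense'; exists hat.
have [That_density inf_S] := S_close.
split => //.
have Ups_ge0 u : S u -> (0 <= Upsilon mu x S u)%E.
  move=> Su; have [theta Tt tu] := S_sub _ Su.
  apply: ereal_sup_ubound; exists u => //; rewrite -tu.
  rewrite (rho_T_eq t_density' Theta_vartheta Q_law ratio_lipschitz M0 Theta_M)//.
  rewrite /rho_test big1; last by move=> i _; rewrite /score subrr mul0r.
  rewrite addr0 /mean_drift.
  under eq_Rintegral do rewrite /drift subrr mul0r.
  by rewrite (expectation_cst Q 0) mulr0.
have inf_ge0 : (0 <= ereal_inf [set Upsilon mu x S u | u in S])%E.
  by apply: le_ereal_inf_tmp => _ [u Su <-]; exact: Ups_ge0.
apply/eqP; rewrite eq_le; apply/andP; split; last first.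
  by apply: le_ereal_inf_tmp => _ [u _ <-]; rewrite lee_fin sqrtr_ge0.
apply/lee_addgt0Pr => e e0; rewrite add0e.
pose B := @bound_const R d A1 M.
pose L := B * @lip_const R d A1 + B ^+ 3 * @lip_const R d A1.
have L0 : 0 <= L.
  by rewrite addr_ge0// mulr_ge0 ?exprn_ge0// (le_trans ler01).
(* The sample size is fixed here: moving the first argument of the test by less than [tau] adds at
   most [n L tau <= 1]. *)
pose tau := (n%:R * L + 1)^-1.
have den0 : 0 < n%:R * L + 1 by rewrite ltr_wpDl// mulr_ge0.
have tau0 : 0 < tau by rewrite invr_gt0.
have [eps eps0 far] := far_sep _ _ That tau0.
(* [e] serves the infimum; since [h^2] is half of [sqdist], [sqrt (eps / 2)] forces [sqdist < eps],
   hence a parameter within [tau] of the MLE. *)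
pose e' := Num.min e (Num.sqrt (2^-1 * eps)).
have e'0 : 0 < e' by rewrite lt_min e0 sqrtr_gt0 mulr_gt0.
have [_ [u Su <-] hu] : exists2 y, [set (hellinger mu (t hat) u)%:E | u in S] y & (y < e'%:E)%E.
  by apply: ereal_inf_lt; rewrite inf_S lte_fin.
have [eta Te tu] := S_sub _ Su.
apply: ge_ereal_inf; exists (hellinger mu (t hat) u)%:E; last first.
  by rewrite lee_fin; move: hu; rewrite lte_fin lt_min => /andP[/ltW].
exists u => //; split => //.
have close : `|eta - hat| < tau.
  rewrite ltNge; apply/negP => /(far _ Te) hfar.
  move: hu; rewrite lte_fin lt_min => /andP[_]; rewrite -tu.
  rewrite (hellingerE t_density' Theta_vartheta Q_law ratio_lipschitz)//.
  rewrite ltNge => /negP; apply; apply: ler_wsqrtr.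
  by rewrite ler_pM2l// (sqdistC t vartheta).
(* 8 for the test at the MLE and 1 for the move to [eta], below [kappa / 10 = 35.7]. *)
have Ups9 : (Upsilon mu x S u <= 9%:E)%E.
  apply: ge_ereal_sup => _ [u' Su' <-].
  have [zeta Tz <-] := S_sub _ Su'; rewrite -tu.
  rewrite (rho_T_eq t_density' Theta_vartheta Q_law ratio_lipschitz M0 Theta_M)// lee_fin.
  have hlip := rho_test_lip Q B1 mW WB W_lip x Te That Tz.
  apply: le_trans hlip _.
  have := Tle8 _ Tz.
  have : n%:R * (L * `|eta - hat|) <= 1.
    rewrite mulrA; apply: (@le_trans _ _ ((n%:R * L + 1) * `|eta - hat|)).
      by rewrite ler_wpM2r// lerDl.
    by rewrite mulrC -ler_pdivlMr// div1r ltW.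
  rewrite /L /B /x; lra.
apply: le_trans Ups9 _.
apply: (@le_trans _ _ (0 + (kappa / 10)%:E)%E).
  by rewrite add0e lee_fin /kappa; lra.
by rewrite leeD2r.
Qed.
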